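(* Let $L$ be an honest time satisfying condition $(\mathbf{A})$: $\mathbb{P}[L=T]=0$ for every $(\mathcal{F}_t)$-stopping time $T$. Write $Z=Z^L$, $A=A^L$. Let $\varphi:\mathbb{R}_+\to\mathbb{R}$ be a continuous function such that $\mathbb{E}[|\varphi(A_\infty)|]<\infty$, or equivalently $\int_0^\infty|\varphi(x)|e^{-x}\,dx<\infty$, and let $$\widehat{\varphi}(x)=e^{x}\int_x^\infty e^{-y}\varphi(y)\,dy.$$ If $\int_0^\infty e^{-x}|\varphi(x)|\,x\,dx<\infty$, then $$\mathbb{E}[\varphi(A_\infty)\mid\mathcal{F}_t]=Z_t\,\widehat{\varphi}(A_t)+(1-Z_t)\,\varphi(A_t).$$
   Context: $(\Omega,\mathcal{F},(\mathcal{F}_t)_{t\ge0},\mathbb{P})$ is a filtered probability space satisfying the usual hypotheses. An honest time is a random time $L:\Omega\to\mathbb{R}_+$ which is the end of an $(\mathcal{F}_t)$-optional set $\Gamma$, $L=\sup\{t:(t,\omega)\in\Gamma\}$; it is assumed that $\mathbb{P}[L=0]=\mathbb{P}[L=\infty]=0$. $Z^L_t=\mathbb{P}[L>t\mid\mathcal{F}_t]$ (càdlàg version); $A^L$ is the $(\mathcal{F}_t)$ dual optional projection of $1_{\{L\le t\}}$ (the increasing right-continuous adapted process with $\mathbb{E}[\int_0^\infty H_s\,dA^L_s]=\mathbb{E}[H_L]$ for all bounded optional $H$). *)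

(* Defs.v *)
From HB Require Import structures.
From mathcomp Require Import all_boot all_order all_algebra.
From mathcomp Require Import all_classical all_reals all_analysis.
From mathcomp Require Import measurable_realfun.

Set Implicit Arguments.
Unset Strict Implicit.
Unset Printing Implicit Defensive.

Import Order.TTheory GRing.Theory Num.Theory.
Import numFieldNormedType.Exports.

Local Open Scope classical_set_scope.
Local Open Scope ring_scope.

(** Time is [0, +oo[ inside [R]: a process or a filtration is indexed by all of
    [R], and its values at negative times play no role (except that increasing
    processes are extended there by 0, see below). *)

Section filtrations.
Context {d : measure_display} {T : measurableType d} {R : realType}.
Variables (P : probability T R) (F : R -> set_system T).

Definition measurable_wrt {U : Type} (D : set U) (S : set_system U)
    (f : U -> R) : Prop :=
  preimage_set_system D f measurable `<=` S.

(** The last clause says both that [P] is complete (every negligible set is an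
    event, since [F 0] consists of events) and that [F 0] contains all null
    sets. *)
Record usual_filtration : Prop := UsualFiltration {
  filtration_sigma : forall t, 0 <= t -> sigma_algebra setT (F t);
  filtration_event : forall t, 0 <= t -> F t `<=` @measurable d T;
  filtration_nondecreasing :
    forall s t, 0 <= s -> s <= t -> F s `<=` F t;
  filtration_right_continuous :
    forall t, 0 <= t -> F t = \bigcap_(s in [set s | t < s]) F s;
  filtration_complete : P.-negligible `<=` F 0 }.

Definition adapted (X : R -> T -> R) : Prop :=
  forall t, 0 <= t -> measurable_wrt setT (F t) (X t).

Definition cadlag (X : R -> T -> R) : Prop :=
  forall w,
    (forall t, 0 <= t -> X s w @[s --> t^'+] --> X t w) /\
    (forall t, 0 < t -> cvg (X s w @[s --> t^'-])).

Definition time_space : set (R * T) := `[0, +oo[%classic `*` setT.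

(** The sigma-algebra on [0, +oo[ x T generated by the adapted processes all of
    whose paths are cadlag. *)
Definition optional : set_system (R * T) :=
  <<s time_space,
      \bigcup_(X in [set X | adapted X /\ cadlag X])
        preimage_set_system time_space (fun p => X p.1 p.2) measurable >>.

Definition optional_process (H : R -> T -> R) : Prop :=
  measurable_wrt time_space optional (fun p => H p.1 p.2).

Definition stopping_time (tau : T -> \bar R) : Prop :=
  (forall w, 0 <= tau w)%E /\
  forall t, 0 <= t -> F t [set w | (tau w <= t%:E)%E].

(** Random times take values in [0, +oo]; the supremum is taken in [0, +oo], so
    it is 0 for an empty section. *)
Definition honest_time (L : T -> \bar R) : Prop :=
  [/\ measurable_fun setT L,
      exists2 Gamma, optional Gamma &
        forall w, L w = ereal_sup ([set 0%E] `|`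
                          [set t%:E | t in [set t | Gamma (t, w)]]),
      P [set w | L w = 0%E] = 0%E &
      P [set w | L w = +oo%E] = 0%E].

Definition avoids_stopping_times (L : T -> \bar R) : Prop :=
  forall tau, stopping_time tau -> P [set w | L w = tau w] = 0%E.

(** [Y] is a version of the conditional expectation of [X] given [G]. *)
Definition cond_expectation (G : set_system T) (X Y : T -> R) : Prop :=
  [/\ P.-integrable setT (EFin \o X),
      P.-integrable setT (EFin \o Y),
      measurable_wrt setT G Y &
      forall B, G B ->
        (\int[P]_(w in B) (Y w)%:E = \int[P]_(w in B) (X w)%:E)%E].

Definition azema_supermartingale (L : T -> \bar R) (Z : R -> T -> R) : Prop :=
  cadlag Z /\
  forall t, 0 <= t ->
    cond_expectation (F t) (\1_[set w | (t%:E < L w)%E]) (Z t).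

(** The paths of [A] are nondecreasing and right-continuous by typing. They are
    extended by 0 to negative times (A_{0-} = 0), so that [dA] has an atom of
    mass A_0 at 0. *)
Definition dual_optional_projection (L : T -> \bar R)
    (A : T -> cumulative R R) : Prop :=
  [/\ forall w t, t < 0 -> A w t = 0,
      adapted (fun t w => A w t) &
      forall H : R -> T -> R, optional_process H ->
        (exists M, forall t w, 0 <= t -> `|H t w| <= M) ->
        (\int[P]_w \int[lebesgue_stieltjes_measure (A w)]_(s in `[0%R, +oo[)
             (H s w)%:E
         = \int[P]_(w in [set w | L w < +oo]) (H (fine (L w)) w)%:E)%E].

(** For a dual optional projection, E[A_oo] = P[L < oo] <= 1, so the limit
    exists almost surely; elsewhere [lim] takes a default value. *)
Definition terminal (A : T -> cumulative R R) (w : T) : R :=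
  lim (A w t @[t --> +oo]).

End filtrations.

Definition phi_hat {R : realType} (phi : R -> R) (x : R) : R :=
  expR x * \int[lebesgue_measure]_(y in `[x, +oo[) (expR (- y) * phi y).

(* Main.v *)
Require Import Defs.
From HB Require Import structures.
From mathcomp Require Import all_boot all_order all_algebra.
From mathcomp Require Import all_classical all_reals all_analysis.
From mathcomp Require Import measurable_realfun ring lra.

(** The idea. Let g be bounded and continuous with primitive G, let t >= 0 and
    let B be an event of F_t. The identity that defines A as a dual optional
    projection, applied to H_s = 1_B 1_(t <= s) g(A_s), reads
      E[1_B int_[t, +oo[ g(A_s) dA_s] = E[1_B 1_(t <= L) g(A_L)].
    Two properties of the paths of A, both valid almost surely, turn it into a
    statement on A_oo: A is continuous, and A does not increase after L. By the
    first one the left-hand side is E[1_B (G(A_oo) - G(A_t))]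
    ([integral_stieltjes_comp]). By the second one A_L = A_oo, and A_oo = A_t if
    L <= t, so that 1_(t < L) g(A_oo) = g(A_oo) - g(A_t) + 1_(t < L) g(A_t).
    Projecting on F_t gives
      E[(g - G)(A_oo) | F_t] = (g - G)(A_t) - Z_t g(A_t)
    ([dual_chain_rule], [bounded_azema_formula]). For psi bounded and
    continuous, the choice G = - phi_hat psi makes g - G equal to psi
    ([is_derive_phi_hat]), and this is the formula. At t = 0 it says that A_oo
    has the exponential distribution ([terminal_law_ge0]), hence the
    equivalence of the two integrability conditions; unbounded functions are
    reached by truncation ([azema_cond_expectation]).

    The two properties of the paths come from the same duality, applied to
    optional sets which the point of time L can only meet when L equals a given
    stopping time, an event that condition (A) makes negligible
    ([dual_indic_null]). For continuity the set is the graph of the first time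
    of a jump of size at least e ([ae_jumps_set0]). For the flatness after L it
    is [q, D[, where D is the first point after q of the optional set that ends
    at L: if q <= L < D then L = q, while D = +oo if L <= q
    ([ae_flat_after_rat]).

    This requires that first entrance times in optional sets be stopping times
    ([debut_stopping_time]), which rests on the measurable projection theorem
    ([proj_analytic]): the projection of a Borel x F_t-measurable set is in the
    complete sigma-algebra F_t. It is proved by showing that such sets are
    analytic and that analytic sets are capacitable. *)

Set Implicit Arguments.
Unset Strict Implicit.
Unset Printing Implicit Defensive.

Import Order.TTheory GRing.Theory Num.Theory.
Import numFieldNormedType.Exports.

Local Open Scope classical_set_scope.
Local Open Scope ring_scope.

(** * Analytic sets *)

Section analytic_sets.
Context {R : realType} {T : Type}.
Variable G : set_system T.
Hypothesis sG : sigma_algebra setT G.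

(** The compact sets of the projection argument: finite unions of rectangles
    with a closed side in time. Their sections in time are closed, and
    restricted to a bounded time interval they have projections in [G]. *)
Inductive kset : set (R * T) -> Prop :=
| kset_rect C B : closed C -> G B -> kset (C `*` B)
| kset_union K1 K2 : kset K1 -> kset K2 -> kset (K1 `|` K2).

Lemma salgT : G setT.
Proof. by case: sG => G0 GC _; rewrite -(setD0 setT); exact: GC. Qed.

Lemma salgC B : G B -> G (~` B).
Proof. by case: sG => G0 GC _; rewrite -setTD; exact: GC. Qed.

Lemma salg_bigcup (B : nat -> set T) : (forall n, G (B n)) -> G (\bigcup_n B n).
Proof. by case: sG => G0 GC GU; exact: GU. Qed.

Lemma salg_bigcap (B : nat -> set T) : (forall n, G (B n)) -> G (\bigcap_n B n).
Proof.
move=> GB; rewrite -(setCK (\bigcap_n _)) setC_bigcap.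
by apply/salgC/salg_bigcup => n; exact: salgC.
Qed.

Lemma salgU A B : G A -> G B -> G (A `|` B).
Proof.
move=> GA GB; rewrite -bigcup2E; apply: salg_bigcup => -[|[|n]] //=.
by case: sG.
Qed.

Lemma salgI A B : G A -> G B -> G (A `&` B).
Proof.
by move=> GA GB; rewrite -(setCK (A `&` B)) setCI; apply/salgC/salgU; exact: salgC.
Qed.

Lemma ksetT : kset setT.
Proof. by rewrite -setXTT; apply: kset_rect; [exact: closedT | exact: salgT]. Qed.

Lemma ksetI K1 K2 : kset K1 -> kset K2 -> kset (K1 `&` K2).
Proof.
move=> k1; elim: k1 K2 => {K1} [C B cC GB K2|K1 K1' _ IH1 _ IH2 K2 k2]; last first.
  by rewrite setIUl; apply: kset_union; [exact: IH1|exact: IH2].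
elim=> {K2} [C' B' cC' GB'|K2 K2' _ IH1 _ IH2]; last first.
  by rewrite setIUr; exact: kset_union.
by rewrite -setXI; apply: kset_rect; [exact: closedI|exact: salgI].
Qed.

Lemma kset_bigsetI n (K : nat -> set (R * T)) :
  (forall i, kset (K i)) -> kset (\big[setI/setT]_(i < n) K i).
Proof.
by move=> kK; elim/big_ind : _ => //; [exact: ksetT|exact: ksetI].
Qed.

Lemma kset_exists_le (m : nat) (K : nat -> set (R * T)) :
  (forall i, kset (K i)) -> kset [set x | exists2 i, (i <= m)%N & K i x].
Proof.
move=> kK; elim: m => [|m IH].
  rewrite (_ : mkset _ = K 0%N) //; apply/seteqP; split=> x.
    by case=> i; rewrite leqn0 => /eqP->.
  by exists 0%N.
rewrite (_ : mkset _ = [set x | exists2 i, (i <= m)%N & K i x] `|` K m.+1).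
  exact: kset_union.
apply/seteqP; split=> x.
  case=> i; rewrite leq_eqVlt => /orP[/eqP->|im] Kx; first by right.
  by left; exists i.
by case=> [[i im Kx]|Kx]; [exists i => //; exact: leqW|exists m.+1].
Qed.

Definition depends_below (n : nat) (S : (nat -> nat) -> set (R * T)) :=
  forall f g, (forall i, (i < n)%N -> f i = g i) -> S f = S g.

(** The Suslin operation over [kset], with schemes indexed by infinite
    sequences instead of finite words; [N n] is the length of the prefix that
    the n-th set looks at. Leaving [N] free makes countable intersections
    easy: the sequences of all the schemes are interleaved into one. *)
Definition analytic (H : set (R * T)) :=
  exists S : nat -> (nat -> nat) -> set (R * T), exists N : nat -> nat,
  [/\ forall n f, kset (S n f), forall n, depends_below (N n) (S n) &
      H = [set x | exists f, forall n, S n f x]].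

(** Intersecting the first sets of a scheme makes it decreasing and lets its
    n-th set look at n terms only; the first n.+1 sets of which the prefix is
    short enough are the ones available at stage n. *)
Lemma analytic_monotone_scheme H : analytic H ->
  exists S : nat -> (nat -> nat) -> set (R * T),
  [/\ forall n f, kset (S n f), forall n, depends_below n (S n),
      forall n f, S n.+1 f `<=` S n f &
      H = [set x | exists f, forall n, S n f x]].
Proof.
move=> [S [N [kS dS ->]]].
pose S' n f i := if (N i <= n)%N then S i f else setT.
exists (fun n f => \big[setI/setT]_(i < n) S' n f i); split.
- move=> n f; apply: kset_bigsetI => i; rewrite /S'.
  by case: ifPn => _; [exact: kS|exact: ksetT].
- move=> n f g fg; apply: eq_bigr => i _; rewrite /S'; case: ifPn => // Nin.
  by apply: dS => j jN; apply: fg; exact: leq_trans jN Nin.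
- move=> n f x; rewrite -!bigcap_mkord => xS i /= il.
  rewrite /S'; case: ifPn => // Nin.
  by have := xS i (leqW il); rewrite /S' (leqW Nin).
- apply/seteqP; split=> x [f xS]; exists f.
    by move=> n; rewrite -bigcap_mkord => i _; rewrite /S'; case: ifP => _; [exact: xS|].
  move=> i; have := xS (maxn i.+1 (N i)); rewrite -bigcap_mkord.
  move=> /(_ i); rewrite /S' leq_maxr; apply => /=.
  by rewrite leq_max leqnn.
Qed.

Lemma analytic_kset K : kset K -> analytic K.
Proof.
move=> kK; exists (fun _ _ => K), (fun=> 0%N); split=> //.
by apply/seteqP; split=> x; [exists (fun=> 0%N)|case=> f /(_ 0%N)].
Qed.

(** The first term of the sequence chooses the member of the union. *)
Lemma analytic_bigcup (H : nat -> set (R * T)) :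
  (forall k, analytic (H k)) -> analytic (\bigcup_k H k).
Proof.
move=> aH; have /choice[S HS] := fun k => analytic_monotone_scheme (aH k).
exists (fun n f => S (f 0%N) n (fun i => f i.+1)), succn; split.
- by move=> n f; case: (HS (f 0%N)).
- move=> n f g fg; rewrite fg//; case: (HS (g 0%N)) => _ + _ _; apply => i ni.
  exact: fg.
- apply/seteqP; split=> x.
    case=> k _; case: (HS k) => _ _ _ -> [f xS].
    by exists (fun i => if i is j.+1 then f j else k).
  case=> f xS; exists (f 0%N) => //; case: (HS (f 0%N)) => _ _ _ ->.
  by exists (fun i => f i.+1).
Qed.

Lemma analytic_bigcap (H : nat -> set (R * T)) :
  (forall k, analytic (H k)) -> analytic (\bigcap_k H k).
Proof.
move=> aH; have /choice[S HS] := fun k => analytic_monotone_scheme (aH k).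
pose dec n : nat * nat := odflt (0%N, 0%N) (unpickle n).
have decK p : dec (pickle p) = p by rewrite /dec pickleK.
exists (fun n f => S (dec n).1 (dec n).2 (fun i => f (pickle ((dec n).1, i)))).
exists (fun n => (\max_(i < (dec n).2) (pickle ((dec n).1, i : nat)).+1)%N).
split.
- by move=> n f; case: (HS (dec n).1).
- move=> n f g fg; case: (HS (dec n).1) => _ + _ _; apply => i ni.
  apply: fg.
  exact: (leq_bigmax_cond (F := fun j : 'I__ => (pickle ((dec n).1, j : nat)).+1)
    (Ordinal ni)).
- apply/seteqP; split=> x.
    move=> xH; have /choice[f xf] : forall k, exists f, forall n, S k n f x.
      by move=> k; have := xH k Logic.I; case: (HS k) => _ _ _ ->.
    exists (fun i => f (dec i).1 (dec i).2) => n.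
    rewrite [X in S _ _ X](_ : _ = f (dec n).1) //.
    by apply/funext => i; rewrite decK.
  case=> f xS k _; case: (HS k) => _ _ _ ->.
  by exists (fun i => f (pickle (k, i))) => n; have := xS (pickle (k, n)); rewrite decK.
Qed.

(** Being analytic is not stable under complement, but being analytic together
    with its complement is; that is how measurable sets are reached. *)
Definition bianalytic H := analytic H /\ analytic (~` H).

Lemma sigma_algebra_bianalytic : sigma_algebra setT bianalytic.
Proof.
split.
- split; last by rewrite setC0; apply/analytic_kset/ksetT.
  apply: analytic_kset.
  rewrite (_ : set0 = (set0 : set R) `*` (set0 : set T)); last by rewrite setX0.
  by apply: kset_rect; [exact: closed0|case: sG].
- by move=> H [aH aCH]; rewrite setTD; split => //; rewrite setCK.
- move=> H bH; split; first by apply: analytic_bigcup => n; case: (bH n).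
  by rewrite setC_bigcup; apply: analytic_bigcap => n; case: (bH n).
Qed.

End analytic_sets.

(** * Capacitability and measurable projection *)

Section prefix_choice.

Definition update (f : nat -> nat) n j := fun i => if i == n then j else f i.

(** Dependent choice of the successive terms of a sequence, for a condition on
    prefixes. *)
Lemma prefix_choice (good : nat -> (nat -> nat) -> Prop) :
  (forall n f g, (forall i, (i < n)%N -> f i = g i) -> good n f -> good n g) ->
  good 0%N (fun=> 0%N) ->
  (forall n f, good n f -> exists j, good n.+1 (update f n j)) ->
  exists f, forall n, good n f.
Proof.
move=> gl g0 gS.
have /choice[J HJ] : forall nf : nat * (nat -> nat), exists j,
    good nf.1 nf.2 -> good nf.1.+1 (update nf.2 nf.1 j).
  move=> [n f]; have [/gS[j gj]|ngf] := pselect (good n f); first by exists j.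
  by exists 0%N.
pose fix F n := if n is k.+1 then update (F k) k (J (k, F k)) else fun=> 0%N.
have FE n i : (i < n)%N -> F n i = F i.+1 i.
  elim: n => // n IH; rewrite ltnS leq_eqVlt => /orP[/eqP->//|lt_in].
  by rewrite -IH//= /update ltn_eqF.
exists (fun i => F i.+1 i) => n; apply: (gl n (F n)); first exact: FE.
by elim: n => //= n IH; exact: (HJ (n, F n)).
Qed.

End prefix_choice.

Section schemes.
Context {R : realType} {T : Type}.
Variable G : set_system T.
Hypothesis sG : sigma_algebra setT G.

(** Bounding the terms of the sequence by [m] leaves finitely many prefixes of
    length n, hence a finite union. *)
Lemma kset_bounded_prefix (m : nat -> nat) n (S : (nat -> nat) -> set (R * T)) :
  (forall f, kset G (S f)) -> depends_below n S ->
  kset G [set x | exists2 f, (forall i, (i < n)%N -> (f i <= m i)%N) & S f x].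
Proof.
elim: n S => [|n IH] S kS dS.
  rewrite (_ : mkset _ = S (fun=> 0%N)) //; apply/seteqP; split=> x.
    by case=> f _; rewrite (dS _ (fun=> 0%N)).
  by exists (fun=> 0%N).
pose S' f := [set x | exists2 j, (j <= m n)%N & S (update f n j) x].
have kS' f : kset G (S' f) by exact: kset_exists_le.
have dS' : depends_below n S'.
  move=> f g fg.
  suff E j : S (update f n j) = S (update g n j).
    by apply/seteqP; split=> x [j jm Sx]; exists j => //; [rewrite -E|rewrite E].
  apply: dS => i; rewrite /update; case: eqVneq => // ni.
  by rewrite ltnS leq_eqVlt (negbTE ni)/=; exact: fg.
rewrite (_ : mkset _ =
  [set x | exists2 f, (forall i, (i < n)%N -> (f i <= m i)%N) & S' f x]).
  exact: IH.
apply/seteqP; split=> x [f fm].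
  move=> Sfx; exists f; first by move=> i ni; exact/fm/leqW.
  exists (f n); first exact: fm.
  rewrite (dS _ f)// => i _; rewrite /update; by case: eqVneq => [->|].
case=> j jm Sx; exists (update f n j) => // i; rewrite /update.
case: eqVneq => [->//|ni]; rewrite ltnS leq_eqVlt (negbTE ni)/=; exact: fm.
Qed.

(** Koenig's lemma: the tree of the prefixes bounded by [m] is finitely
    branching, so a point lying at every level lies on an infinite branch. *)
Lemma bounded_branch (m : nat -> nat) (S : nat -> (nat -> nat) -> set (R * T)) x :
  (forall n, depends_below n (S n)) -> (forall n f, S n.+1 f `<=` S n f) ->
  (forall n, exists2 f, (forall i, (i < n)%N -> (f i <= m i)%N) & S n f x) ->
  exists f, forall n, S n f x.
Proof.
move=> dS decS Sx.
have dec f k n : (k <= n)%N -> S n f x -> S k f x.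
  move=> /subnK <-; elim: (n - k)%N => // j IH /decS; exact: IH.
pose good n f := forall k, exists g : nat -> nat,
  [/\ forall i, (i < k)%N -> (g i <= m i)%N,
      forall i, (i < n)%N -> g i = f i & S k g x].
have [|||f fP] := @prefix_choice good.
- move=> n f g fg gf k; have [h [hm hf hS]] := gf k; exists h; split=> // i ni.
  by rewrite hf// fg.
- by move=> k; have [f fm fS] := Sx k; exists f.
- move=> n f gf; apply: contrapT => /forallNP bad.
  have /choice[K KP] : forall j, exists k, forall g, ~
      [/\ forall i, (i < k)%N -> (g i <= m i)%N,
      forall i, (i < n.+1)%N -> g i = update f n j i & S k g x].
    by move=> j; have /existsNP[k /forallNP ?] := bad j; exists k.
  pose N := maxn n.+1 (\max_(j < (m n).+1) K j).
  have [g [gm gfn gS]] := gf N.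
  have gn : (g n <= m n)%N by apply: gm; rewrite /N leq_max ltnSn.
  have KN : (K (g n) <= N)%N.
    rewrite /N leq_max; apply/orP; right.
    have gn' : (g n < (m n).+1)%N by [].
    exact: (leq_bigmax (F := fun j : 'I__ => K j) (Ordinal gn')).
  apply: (KP (g n) g); split.
  + by move=> i iK; apply: gm; exact: leq_trans iK KN.
  + move=> i; rewrite /update ltnS leq_eqVlt; case: eqVneq => [->//|_ /=].
    exact: gfn.
  + exact: dec KN gS.
exists f => n; have [g [_ gf gS]] := fP n n.
by rewrite (dS n f g)// => i ni; rewrite gf.
Qed.

Lemma kset_section_closed (K : set (R * T)) w :
  kset G K -> closed [set u | K (u, w)].
Proof.
elim=> {K} [C B cC _|K1 K2 _ c1 _ c2]; last exact: closedU.
have [Bw|Bw] := pselect (B w).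
  by rewrite (_ : mkset _ = C)//; apply/seteqP; split=> u //= [].
by rewrite (_ : mkset _ = set0); [exact: closed0|apply/seteqP; split=> u //= []].
Qed.

Definition box (M : R) : set (R * T) := `[- M, M]%classic `*` setT.

Definition proj (H : set (R * T)) : set T := [set w | exists u, H (u, w)].

Lemma proj_kset (K : set (R * T)) M : kset G K -> G (proj (K `&` box M)).
Proof.
elim=> {K} [C B cC GB|K1 K2 _ c1 _ c2]; last first.
  rewrite (_ : proj _ = proj (K1 `&` box M) `|` proj (K2 `&` box M)).
    exact: salgU.
  apply/seteqP; split=> w.
    by case=> u [[K1u|K2u] bu]; [left|right]; exists u.
  by case=> -[u [Ku bu]]; exists u; split=> //; [left|right].
have [[u [Cu Mu]]|nCM] := pselect (exists u, C u /\ `[- M, M]%classic u).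
  rewrite (_ : proj _ = B)//; apply/seteqP; split=> w.
    by case=> ? [[]].
  by move=> Bw; exists u.
rewrite (_ : proj _ = set0); first by case: sG.
apply/seteqP; split=> w //= -[u [[Cu _] [Mu _]]]; apply: nCM.
by exists u.
Qed.

(** Projection commutes with decreasing intersections of compact sections: the
    points chosen in the sections accumulate in the bounded time interval, and
    a cluster point lies in all of the closed sections. *)
Lemma bigcap_proj_kset (K : nat -> set (R * T)) M :
  (forall n, kset G (K n)) -> (forall n, K n.+1 `<=` K n) ->
  \bigcap_n proj (K n `&` box M) `<=` proj (\bigcap_n K n `&` box M).
Proof.
move=> kK decK w Kw.
have dec i j x : (i <= j)%N -> K j x -> K i x.
  by move=> /subnK <-; elim: (j - i)%N => // k IH /decK; exact: IH.
have /choice[u Ku] : forall n, exists u, (K n `&` box M) (u, w).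
  by move=> n; exact: Kw.
have := @segment_compact R (- M) M.
move=> /(_ (u @ \oo) _) [].
  by exists 0%N => // n _; have [_ []] := Ku n.
move=> x [Mx clx]; exists x; split=> // n _.
apply: (kset_section_closed (w := w) (kK n)) => B Bx.
apply: clx => //; exists n => // k /= nk; have [+ _] := Ku k.
exact: dec.
Qed.

End schemes.

Section measurable_projection.
Context {R : realType} {d : measure_display} {T : measurableType d}.
Variables (P : probability T R) (G : set_system T).
Hypotheses (sG : sigma_algebra setT G) (GT : G `<=` @measurable d T)
  (nG : P.-negligible `<=` G).

(** The outer probability of [E] exceeds [c], up to attainment of the infimum;
    this form avoids outer measures and measurable hulls. *)
Definition outer_gt (c : \bar R) (E : set T) :=
  forall B, measurable B -> E `<=` B -> (c < P B)%E.

(** Outer probability is continuous along increasing sequences of arbitrary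
    sets: given measurable covers [B n] of the [E n] of small probability, the
    sets [C n], intersections of the later covers, still cover and increase. *)
Lemma outer_gt_bigcup c (E : nat -> set T) : (forall n, E n `<=` E n.+1) ->
  outer_gt c (\bigcup_n E n) -> exists n, outer_gt c (E n).
Proof.
move=> Einc cE; apply: contrapT => /forallNP nE.
have inc i j : (i <= j)%N -> E i `<=` E j.
  by move=> /subnK <-; elim: (j - i)%N => // k IH; apply: subset_trans IH _.
have /choice[B BP] : forall n, exists B,
    [/\ measurable B, E n `<=` B & (P B <= c)%E].
  move=> n; have /existsNP[B /not_implyP[mB /not_implyP[EB /negP]]] := nE n.
  by rewrite -leNgt => Bc; exists B.
pose C n := \bigcap_(k in [set k | (n <= k)%N]) B k.
have mC n : measurable (C n).
  by apply: bigcap_measurable; [exists n => /=|move=> k _; case: (BP k)].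
have EC n : E n `<=` C n.
  move=> w Ew k /= nk; case: (BP k) => _ + _; apply; exact: inc nk _ Ew.
have PC n : (P (C n) <= c)%E.
  have [mB _ Bc] := BP n; apply: le_trans Bc.
  by apply: le_measure; rewrite ?inE// => w; apply => /=.
have := cE _ (bigcupT_measurable C mC) (subset_bigcup (fun i _ => EC i)).
rewrite ltNge => /negP; apply.
have ndC : nondecreasing_seq C.
  move=> i j ij; apply/subsetPset => w Cw k /= jk; apply: Cw => /=.
  exact: leq_trans jk.
have cvC := nondecreasing_cvg_mu (mu := P) mC (bigcupT_measurable C mC) ndC.
have /cvg_lim <- // := cvC.
apply: lime_le; first by apply/cvg_ex; eexists; exact: cvC.
by near=> n; exact: PC.
Unshelve. all: end_near. Qed.

(** Choquet's capacitability. Bounding the terms of the sequence one after the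
    other costs nothing in outer probability, by [outer_gt_bigcup]; once all of
    them are bounded by some [m], the set left is a decreasing intersection of
    compact sets, whose projection is in [G]. *)
Lemma analytic_inner_approx (H : set (R * T)) M c : analytic G H ->
  outer_gt c (proj (H `&` box M)) ->
  exists L, [/\ G L, L `<=` proj (H `&` box M) & (c <= P L)%E].
Proof.
move=> /(analytic_monotone_scheme sG)[S [kS dS decS ->]] cH.
pose E n (m : nat -> nat) := proj ([set x | exists2 f,
  (forall i, (i < n)%N -> (f i <= m i)%N) & forall k, S k f x] `&` box M).
have [|||m mP] := @prefix_choice (fun n m => outer_gt c (E n m)).
- move=> n f g fg; rewrite (_ : E n f = E n g)//; rewrite /E; congr proj.
  by apply/seteqP; split=> x [[h hf hS] bx]; split=> //; exists h => // i ni;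
    [rewrite -fg//|rewrite fg//]; exact: hf.
- rewrite (_ : E _ _ = proj ([set x | exists f, forall n, S n f x] `&` box M))//.
  rewrite /E; congr proj; apply/seteqP; split=> x.
    by case=> -[h _ hS] bx; split=> //; exists h.
  by case=> -[h hS] bx; split=> //; exists h.
- move=> n m cE; apply: (@outer_gt_bigcup c (fun j => E n.+1 (update m n j))).
    move=> j w [u [[f fm fS] bu]]; exists u; split=> //; exists f => // i ni.
    have := fm i ni; rewrite /update; case: eqVneq => // _; exact: leqW.
  rewrite (_ : bigcup _ _ = E n m)//; apply/seteqP; split=> w.
    case=> j _ [u [[f fm fS] bu]]; exists u; split=> //; exists f => // i ni.
    by have := fm i (leqW ni); rewrite /update ltn_eqF.
  case=> u [[f fm fS] bu]; exists (f n) => //; exists u; split=> //; exists f => //.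
  move=> i; rewrite /update; case: eqVneq => [->//|ni].
  by rewrite ltnS leq_eqVlt (negbTE ni)/=; exact: fm.
pose K n := [set x | exists2 f, (forall i, (i < n)%N -> (f i <= m i)%N) & S n f x].
have kK n : kset G (K n) by apply: kset_bounded_prefix.
have decK n : K n.+1 `<=` K n.
  by move=> x [f fm /decS Sf]; exists f => // i ni; exact/fm/leqW.
pose L n := proj (K n `&` box M).
have GL n : G (L n) by exact: proj_kset.
have decL n : L n.+1 `<=` L n by move=> w [u [/decK Ku bu]]; exists u.
exists (\bigcap_n L n); split.
- exact: salg_bigcap.
- apply: subset_trans (bigcap_proj_kset kK decK) _ => w [u [Ku bu]].
  exists u; split=> //; apply: bounded_branch => // n; exact: Ku.
- have mL n : measurable (L n) by exact: GT.
  have niL : nonincreasing_seq L.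
    by apply/nonincreasing_seqP => n; apply/subsetPset/decL.
  have cvL := nonincreasing_cvg_mu (mu := P)
    (le_lt_trans (probability_le1 P (mL 0%N)) (ltry 1)) mL
    (bigcapT_measurable mL) niL.
  have /cvg_lim <- // := cvL.
  apply: lime_ge; first by apply/cvg_ex; eexists; exact: cvL.
  near=> n; apply/ltW/(mP n) => // w [u [[f fm fS] bu]].
  by exists u; split=> //; exists f.
Unshelve. all: end_near. Qed.

(** The inner approximations fill the projection up to a null set, and [G]
    contains all of the null sets. *)
Lemma proj_analytic_box (H : set (R * T)) M : analytic G H ->
  G (proj (H `&` box M)).
Proof.
move=> aH; set E := proj _.
pose I := ereal_inf [set P B | B in [set B | measurable B /\ E `<=` B]].
have I0 : (0 <= I)%E by apply: le_ereal_inf_tmp => _ [B _ <-]; exact: measure_ge0.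
have I1 : (I <= 1)%E.
  by apply: ereal_inf_lbound; exists setT; rewrite ?probability_setT.
have fI : I \is a fin_num.
  by rewrite ge0_fin_numE// (le_lt_trans I1)// ltry.
have e0 n : (0 < n.+1%:R^-1 :> R) by rewrite invr_gt0.
have /choice[L LP] : forall n, exists L,
    [/\ G L, L `<=` E & (I - (n.+1%:R^-1)%:E <= P L)%E].
  move=> n; apply: analytic_inner_approx => // B mB EB.
  apply: (@lt_le_trans _ _ I); last by apply: ereal_inf_lbound; exists B.
  by rewrite lteBlDr// lteDl// lte_fin.
have /choice[B BP] : forall n, exists B,
    [/\ measurable B, E `<=` B & (P B < I + (n.+1%:R^-1)%:E)%E].
  move=> n; have [_ [B [mB EB] <-] BI] := lb_ereal_inf_adherent (e0 n) fI.
  by exists B.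
have GL : G (\bigcup_n L n) by apply: salg_bigcup => // n; case: (LP n).
have LE : \bigcup_n L n `<=` E by move=> w [n _]; case: (LP n) => _ + _; exact.
rewrite -(setDUK LE); apply: salgU => //; apply: nG.
exists (\bigcap_n B n `\` \bigcup_n L n).
have mB : measurable (\bigcap_n B n).
  by apply: bigcapT_measurable => n; case: (BP n).
have mL : measurable (\bigcup_n L n) by exact: GT.
split; first exact: measurableD.
- apply/eqP; rewrite eq_le measure_ge0 andbT; apply/lee_addgt0Pr => e e_gt0.
  rewrite add0e.
  pose n := Num.bound (2 / e).
  have [GLn LnE ILn] := LP n; have [mBn EBn BnI] := BP n.
  apply: (@le_trans _ _ (P (B n `\` L n))).
    apply: le_measure; rewrite ?inE; [exact: measurableD| |].
      by apply: measurableD => //; exact: GT.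
    by move=> w [Bw Lw]; split; [exact: Bw|contradict Lw; exists n].
  have mLn : measurable (L n) by exact: GT.
  rewrite measureD//; last by rewrite (le_lt_trans (probability_le1 P mBn))// ltry.
  rewrite (_ : B n `&` L n = L n); last by apply/setIidPr/(subset_trans LnE).
  apply: (@le_trans _ _ ((I + (n.+1%:R^-1)%:E) - (I - (n.+1%:R^-1)%:E))%E).
    by apply: leeB => //; exact: ltW.
  rewrite -(fineK fI) lee_fin.
  rewrite (_ : _ - _ = n.+1%:R^-1 * 2); last by rewrite /=; ring.
  have bn : 2 / e < n%:R by apply: archi_boundP; rewrite divr_ge0// ltW.
   rewrite mulrC ler_pdivrMr// mulrC.
  by rewrite -ler_pdivrMr//; apply/ltW/(lt_trans bn); rewrite ltr_nat.
- move=> w [Ew Lw]; split=> // n _; case: (BP n) => _ + _; exact.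
Qed.

(** Measurable projection theorem. *)
Theorem proj_analytic (H : set (R * T)) : analytic G H -> G (proj H).
Proof.
move=> aH; rewrite (_ : proj H = \bigcup_n proj (H `&` box n%:R)).
  by apply: salg_bigcup => // n; exact: proj_analytic_box.
apply/seteqP; split=> w; last by case=> n _ [u [Hu _]]; exists u.
move=> [u Hu]; exists (Num.bound `|u|) => //; exists u; split=> //; split=> //=.
rewrite in_itv/= -ler_norml; by apply/ltW/archi_boundP.
Qed.

End measurable_projection.

(** * Debuts of optional sets are stopping times *)

Section sub_sigma_algebra.
Context {R : realType} {T : pointedType}.
Variable G : set_system T.
Hypothesis sG : sigma_algebra setT G.

Lemma measurable_sub_sigma_algebra (B : set T) :
  measurable (B : set (g_sigma_algebraType G)) <-> G B.
Proof. by rewrite measurable_g_measurableTypeE// sigma_algebra_id. Qed.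

(** Measurability with respect to a sub-sigma-algebra is measurability on the
    type that carries it, which gives access to the general closure lemmas. *)
Lemma measurable_wrtP (f : T -> R) : measurable_wrt setT G f <->
  measurable_fun setT (f : g_sigma_algebraType G -> R).
Proof.
split=> [mf _ Y mY|mf _ [Y mY <-]].
  by apply/measurable_sub_sigma_algebra; apply: mf; exists Y.
by have /measurable_sub_sigma_algebra := mf measurableT Y mY.
Qed.

Lemma bianalyticC (H : set (R * T)) : bianalytic G H -> bianalytic G (~` H).
Proof. by move=> bH; exact: (salgC (sigma_algebra_bianalytic sG) bH). Qed.

Lemma bianalyticI (H K : set (R * T)) :
  bianalytic G H -> bianalytic G K -> bianalytic G (H `&` K).
Proof. by move=> bH bK; exact: (salgI (sigma_algebra_bianalytic sG) bH bK). Qed.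

Lemma bianalytic_time_closed (C : set R) :
  closed C -> closed (~` C) \/ (exists D : nat -> set R,
    (forall n, closed (D n)) /\ ~` C = \bigcup_n D n) ->
  bianalytic G (C `*` setT).
Proof.
move=> cC cD; split.
  by apply: analytic_kset => //; apply: kset_rect => //; exact: salgT.
rewrite (_ : ~` _ = ~` C `*` setT); last first.
  by apply/seteqP; split=> -[u w] /=; [move=> h; split=> // Cu; exact: h|case=> h _ []].
case: cD => [cC'|[D [cD ->]]].
  by apply: analytic_kset => //; apply: kset_rect => //; exact: salgT.
rewrite (_ : _ `*` _ = \bigcup_n (D n `*` setT)).
  apply: analytic_bigcup => // n.
  by apply: analytic_kset => //; apply: kset_rect => //; exact: salgT.
apply/seteqP; split=> -[u w] /=; first by case=> -[n _ Du] _; exists n.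
by case=> n _ [Du _]; split=> //; exists n.
Qed.

Lemma bianalytic_le (b : R) : bianalytic G (`]-oo, b]%classic `*` setT).
Proof.
apply: bianalytic_time_closed; first exact: interval_closed.
right; exists (fun n => `[b + n.+1%:R^-1, +oo[%classic); split.
  by move=> n; exact: interval_closed.
rewrite setCitvl; apply/seteqP; split=> x /=.
  rewrite in_itv/= andbT -subr_gt0 => bx.
  exists (Num.bound (x - b)^-1) => //=.
  rewrite in_itv/= andbT addrC -lerBrDr invf_ple ?posrE//.
  have h : (x - b)^-1 < (Num.bound (x - b)^-1)%:R.
    by apply: archi_boundP; rewrite invr_ge0 ltW.
  by apply/ltW/(lt_trans h); rewrite ltr_nat.
case=> n _ /=; rewrite !in_itv/= !andbT; apply: lt_le_trans.
by rewrite ltrDl invr_gt0.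
Qed.

Lemma bianalytic_time (A : set R) : measurable A -> bianalytic G (A `*` setT).
Proof.
move=> mA; suff : [set A : set R | bianalytic G (A `*` setT)] A by [].
move: A mA; apply: smallest_sub.
  have [b0 bC bU] := sigma_algebra_bianalytic (R := R) sG; split => /=.
  - by rewrite set0X.
  - move=> A /bianalyticC; rewrite setTD.
    rewrite (_ : ~` (A `*` _) = ~` A `*` setT)//.
    by apply/seteqP; split=> -[u w] /=; [move=> h; split=> // Au; exact: h|case=> h _ []].
  - move=> A bA; rewrite (_ : _ `*` _ = \bigcup_n (A n `*` setT)); first exact: bU.
    apply/seteqP; split=> -[u w] /=; first by case=> -[n _ Du] _; exists n.
    by case=> n _ [Du _]; split=> //; exists n.
move=> _ [[a b] _ <-] /=.
rewrite (_ : _ `*` _ = (`]-oo, b]%classic `*` setT) `&` ~` (`]-oo, a]%classic `*` setT)).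
  by apply: bianalyticI; [|apply: bianalyticC]; exact: bianalytic_le.
apply/seteqP; split=> -[u w] /=; rewrite !in_itv/=.
  by case=> /andP[au ->] _; split=> // -[]; rewrite leNgt au.
by case=> -[-> _] nua; split=> //; rewrite andbT ltNge; apply/negP => ua; apply: nua.
Qed.

(** Borel x [G]-measurable sets are bianalytic: a sigma-algebra that contains
    the rectangles. *)
Lemma bianalytic_measurable_prod (H : set (R * g_sigma_algebraType G)) :
  measurable H -> bianalytic G (H : set (R * T)).
Proof.
rewrite measurable_prod_measurableType; move: H; apply: smallest_sub.
  exact: sigma_algebra_bianalytic.
move=> _ [A mA [B /measurable_sub_sigma_algebra GB <-]].
rewrite (_ : _ `*` _ = (A `*` setT) `&` (setT `*` B)); last first.
  by apply/seteqP; split=> -[u w] /=; [case|case=> -[? _] []].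
apply: bianalyticI; first exact: bianalytic_time.
split; first by apply: analytic_kset => //; exact: kset_rect.
rewrite (_ : ~` _ = setT `*` ~` B); last first.
  by apply/seteqP; split=> -[u w] /=; [move=> h; split=> // Cu; exact: h|case=> _ h [_]].
by apply: analytic_kset => //; apply: kset_rect => //; exact: salgC.
Qed.

End sub_sigma_algebra.

Section debut.
Context {R : realType} {d : measure_display} {T : measurableType d}.
Variables (P : probability T R) (F : R -> set_system T).
Hypothesis uF : usual_filtration P F.

Local Notation time_space := (@time_space d T R).

Definition before (s : R) : set (R * T) := `[0, s[%classic `*` setT.

Lemma before_time_space s : before s `<=` time_space.
Proof.
by move=> [u w] [/=]; rewrite in_itv/= => /andP[u0 _] _; split=> //=; rewrite in_itv/= u0.
Qed.

(** The right endpoint of the cell of mesh 1/(n+1) that contains [u], capped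
    at [s] so that it does not look beyond time [s]. *)
Definition right_mesh (s : R) n (u : R) : R :=
  Num.min s ((Num.truncn (u * n.+1%:R)).+1%:R / n.+1%:R).

Lemma right_mesh_gt s n u : 0 <= u < s -> u < right_mesh s n u.
Proof.
move=> /andP[u0 us]; rewrite /right_mesh lt_min us/= ltr_pdivlMr//.
by rewrite truncnS_gt.
Qed.

Lemma right_mesh_cvg s u : 0 <= u < s -> right_mesh s n u @[n --> \oo] --> u.
Proof.
move=> us; have /andP[u0 _] := us.
apply: (squeeze_cvgr (f := cst u) (h := fun n => u + n.+1%:R^-1)).
- near=> n; rewrite ltW ?right_mesh_gt//= /right_mesh ge_min; apply/orP; right.
  rewrite ler_pdivrMr// mulrDl mulVf// -natr1 lerD2r.
  by rewrite truncn_le mulr_ge0.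
- exact: cvg_cst.
- rewrite -[X in _ --> X]addr0; apply: cvgD; first exact: cvg_cst.
  exact: cvg_harmonic.
Unshelve. all: end_near. Qed.

(** Cadlag adapted processes are progressive: by right-continuity the process
    is the limit of its samples at the right endpoints of finer and finer
    meshes. *)
Lemma cadlag_adapted_measurable (X : R -> T -> R) s : adapted F X -> cadlag X ->
  measurable_fun (before s : set (R * g_sigma_algebraType (F s)))
    (fun p => X p.1 p.2).
Proof.
move=> aX cX; have [s0|s0] := leP s 0.
  rewrite /before set_itv_ge ?set0X; last by rewrite bnd_simp -leNgt.
  exact: measurable_fun_set0.
have sF := filtration_sigma uF (ltW s0).
apply: (measurable_fun_cvg (h := fun n (p : R * g_sigma_algebraType (F s)) =>
  X (right_mesh s n p.1) p.2)).
  move=> n mD Y mY.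
  pose c k := Num.min s (k.+1%:R / n.+1%:R).
  rewrite (_ : _ `&` _ = \bigcup_k (
    ([set u | 0 <= u < s] `&` `[k%:R / n.+1%:R, k.+1%:R / n.+1%:R[%classic) `*`
    ((X (c k) @^-1` Y) : set (g_sigma_algebraType (F s))))).
    apply: bigcupT_measurable => k; apply: measurableX.
      apply: measurableI => //.
      by rewrite (_ : mkset _ = `[0, s[%classic)//; apply/seteqP; split=> x /=; rewrite in_itv.
    apply/measurable_sub_sigma_algebra => //.
    have c0 : 0 <= c k by rewrite /c le_min ltW//= divr_ge0.
    have cs : c k <= s by rewrite /c ge_min lexx.
    apply: (filtration_nondecreasing uF c0 cs); apply: (aX _ c0).
    by exists Y => //; rewrite setTI.
  apply/seteqP; split=> -[u w] /=.
    move=> -[[/= + _] Yu]; rewrite in_itv/= => us; have /andP[u0 _] := us.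
    exists (Num.truncn (u * n.+1%:R)) => //=; split => //; split=> //.
    by rewrite in_itv/= ler_pdivrMr// ltr_pdivlMr// truncnS_gt truncn_le mulr_ge0.
  case=> k _ [[us /= +] Yu]; rewrite in_itv/= => /andP[ku uk].
  split; first by split=> //=; rewrite in_itv.
  suff -> : right_mesh s n u = c k by [].
  rewrite /right_mesh /c; congr (Num.min _ (_.+1%:R / _)).
  apply/eqP; rewrite truncn_eq; last by rewrite mulr_ge0//; case/andP: us.
  by rewrite -ler_pdivrMr// ku -ltr_pdivlMr.
move=> [u w] [/=]; rewrite in_itv/= => us _.
have /andP[u0 _] := us.
have [rc _] := cX w; have := rc _ u0.
move/cvg_at_rightP; apply; split; last exact: right_mesh_cvg.
by move=> n; exact: right_mesh_gt.
Qed.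

Lemma optional_time_space (H : set (R * T)) : optional F H -> H `<=` time_space.
Proof.
move: H; apply: smallest_sub.
  split; [exact: sub0set|by move=> A _ x []|].
  by move=> A AD; apply: bigcup_sub => n _; exact: AD.
by move=> _ [X _ [Y _ <-]] x [].
Qed.

Lemma optional_progressive (H : set (R * T)) s : 0 <= s ->
  optional F H -> bianalytic (F s) (H `&` before s).
Proof.
move=> s0 oH.
have sF := filtration_sigma uF s0.
suff : [set H | bianalytic (F s) (H `&` before s)] H by [].
have [b0 _ bU] := @sigma_algebra_bianalytic R T _ sF.
move: H oH; apply: smallest_sub.
  split=> /=.
  - by rewrite set0I.
  - move=> A bA; rewrite (_ : _ `&` _ = before s `&` ~` (A `&` before s)).
      apply: bianalyticI => //; last exact: bianalyticC.
      exact: bianalytic_time.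
    apply/seteqP; split=> x /=.
      by case=> -[_ nA] bx; split=> // -[].
    case=> bx nA; split=> //; split; first exact: before_time_space bx.
    by move=> Ax; apply: nA.
  - by move=> A bA; rewrite setI_bigcupl; exact: bU.
move=> _ [X [aX cX] [Y mY <-]] /=; apply: bianalytic_measurable_prod => //.
rewrite (_ : _ `&` _ = before s `&` (fun p => X p.1 p.2) @^-1` Y); last first.
  apply/seteqP; split=> x; first by case=> -[_ Yx] bx.
  by case=> bx Yx; split=> //; split=> //; exact: before_time_space bx.
apply: cadlag_adapted_measurable => //.
by apply: measurableX => //; exact: measurableT.
Qed.

Definition debut (H : set (R * T)) (w : T) : \bar R :=
  ereal_inf [set t%:E | t in [set t | H (t, w)]].

Lemma debut_lt (H : set (R * T)) w (s : R) :
  (debut H w < s%:E)%E <-> exists2 u, u < s & H (u, w).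
Proof.
split=> [/ereal_inf_lt[_ [u Hu <-]]|[u us Hu]]; first by rewrite lte_fin; exists u.
by apply: (@le_lt_trans _ _ u%:E); [apply: ereal_inf_lbound; exists u|rewrite lte_fin].
Qed.

(** The debut is before [s] exactly on the projection of the part of [H] that
    precedes [s]; right-continuity of the filtration passes from strict to
    large inequality. *)
Lemma debut_stopping_time (H : set (R * T)) :
  optional F H -> stopping_time F (debut H).
Proof.
move=> oH; split.
  move=> w; apply: le_ereal_inf_tmp => _ [u Hu <-].
  by have [/=] := optional_time_space oH Hu; rewrite in_itv/= andbT lee_fin.
move=> t t0; rewrite (filtration_right_continuous uF t0) => s /= ts.
have s0 : 0 <= s by rewrite (le_trans t0)// ltW.
have Flt r : 0 <= r -> F r [set w | (debut H w < r%:E)%E].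
  move=> r0; rewrite (_ : mkset _ = proj (H `&` before r)).
    have sF := filtration_sigma uF r0.
    apply: (proj_analytic (P := P)) => //.
    - exact: (filtration_event uF r0).
    - apply: subset_trans (filtration_complete uF) _.
      exact: (filtration_nondecreasing uF (lexx 0) r0).
    - by case: (optional_progressive r0 oH).
  apply/seteqP; split=> w /=.
    move=> /debut_lt[u ur Hu]; exists u; split=> //; split=> //=.
    rewrite in_itv/= ur andbT; have [/=] := optional_time_space oH Hu.
    by rewrite in_itv/= andbT.
  move=> [u [Hu [/= + _]]]; rewrite in_itv/= => /andP[_ ur].
  by apply/debut_lt; exists u.
pose r n := t + (s - t) / n.+1%:R.
have st : 0 < s - t by rewrite subr_gt0.
rewrite (_ : mkset _ = \bigcap_n [set w | (debut H w < (r n)%:E)%E]).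
  apply: salg_bigcap; first exact: (filtration_sigma uF s0).
  move=> n; have rn0 : 0 <= r n by rewrite addr_ge0// divr_ge0// ltW.
  apply: (filtration_nondecreasing uF rn0) (Flt _ rn0).
  by rewrite /r -lerBrDl ler_pdivrMr// ler_peMr// ?ler1n// ltW.
apply/seteqP; split=> w /=.
  move=> Dt n _ /=; apply: le_lt_trans Dt _; rewrite lte_fin /r ltrDl.
  by rewrite divr_gt0.
move=> Dr; apply/lee_addgt0Pr => e e0.
have := Dr (Num.bound ((s - t) / e)) Logic.I => /= /ltW/le_trans; apply.
rewrite -EFinD lee_fin /r lerD2l ler_pdivrMr// mulrC -ler_pdivrMr//.
have h : (s - t) / e < (Num.bound ((s - t) / e))%:R.
  by apply: archi_boundP; rewrite divr_ge0// ltW.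
by apply/ltW/(lt_trans h); rewrite ltr_nat.
Qed.

End debut.

(** * Integration along the paths of an increasing process *)

Section integral_lemmas.
Context {d : measure_display} {T : measurableType d} {R : realType}.
Variable mu : {measure set T -> \bar R}.

(** The integral of a nonnegative function is a supremum over the simple
    functions below it, hence monotone. The lemma serves for integrals along the
    paths of an increasing process, whose measurability in the outcome is not
    known beforehand. *)
Lemma ge0_le_integral_nonmeasurable (f1 f2 : T -> \bar R) :
  (forall x, 0 <= f1 x)%E -> (forall x, f1 x <= f2 x)%E ->
  (\int[mu]_x f1 x <= \int[mu]_x f2 x)%E.
Proof.
move=> f10 f12; rewrite !ge0_integralTE//; last first.
  by move=> x; exact: le_trans (f10 x) (f12 x).
apply: ge_ereal_sup => _ [h hf <-]; apply: ereal_sup_ubound; exists h => // x.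
exact: le_trans (hf x) (f12 x).
Qed.

Lemma markov_nonmeasurable (N : set T) (k : R) (f : T -> \bar R) :
  measurable N -> 0 <= k -> (forall x, 0 <= f x)%E ->
  (forall x, N x -> k%:E <= f x)%E -> (k%:E * mu N <= \int[mu]_x f x)%E.
Proof.
move=> mN k0 f0 kf; rewrite -integral_cst// integral_mkcond.
apply: ge0_le_integral_nonmeasurable => x; rewrite patchE; case: ifPn => //.
by rewrite inE; exact: kf.
Qed.

Lemma integral_mrestr (D : set T) (mD : measurable D) (f : T -> \bar R) :
  measurable_fun setT f ->
  (\int[mrestr mu mD]_x f x = \int[mu]_(x in D) f x)%E.
Proof.
move=> mf; rewrite -(setUv D) integral_setU//.
- rewrite (@null_set_integral _ _ _ _ (~` D)) ?adde0//.
  + by apply: eq_measure_integral => A mA AD; rewrite /= /mrestr (setIidl AD).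
  + exact: measurableC.
  + exact: measurable_funTS.
  + by rewrite /= /mrestr setICl measure0.
- exact: measurableC.
- exact: measurable_funTS.
- by apply/disj_setPS => x [].
Qed.

End integral_lemmas.

Section stieltjes.
Context {R : realType} (f : cumulative R R).
Local Notation mu := (lebesgue_stieltjes_measure f).

Let f_nd x y : x <= y -> f x <= f y.
Proof. by move=> xy; exact: cumulative_is_nondecreasing. Qed.

Lemma stieltjes_oc (a b : R) : a <= b -> mu `]a, b]%classic = (f b - f a)%:E.
Proof.
move=> ab; rewrite /lebesgue_stieltjes_measure /measure_extension.
by rewrite measurable_mu_extE/= ?wlength_itv_bnd//; exact: is_ocitv.
Qed.

Lemma stieltjes_jump (u e : R) : (forall v, v < u -> e <= f u - f v) ->
  (e%:E <= mu [set u])%E.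
Proof.
move=> ju; pose E n := `]u - n.+1%:R^-1, u]%classic : set (measurableTypeR R).
have uE n : u - n.+1%:R^-1 < u by rewrite ltrBlDr ltrDl invr_gt0.
have mE n : measurable (E n) by exact: measurable_itv.
have cvE : mu (E n) @[n --> \oo] --> mu [set u].
  rewrite set1_bigcap_oc; apply: nonincreasing_cvg_mu => //.
  - by rewrite /= /E stieltjes_oc ?ltry// ltW.
  - exact: bigcapT_measurable.
  - move=> m n mn; apply/subsetPset => x; rewrite /E /= !in_itv/=.
    move=> /andP[lx ->]; rewrite andbT; apply: le_lt_trans lx.
    by rewrite lerB// lef_pV2 ?posrE// ler_nat.
move/cvg_lim : (cvE) => <- //; apply: lime_ge; first by apply/cvg_ex; eexists; exact: cvE.
by near=> n; rewrite /= /E stieltjes_oc ?lee_fin ?ju// ltW.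
Unshelve. all: end_near. Qed.

Lemma stieltjes_co_ge (a b : R) : a <= b -> ((f b - f a)%:E <= mu `[a, +oo[%classic)%E.
Proof.
move=> ab; rewrite -stieltjes_oc//; apply: le_measure; rewrite ?inE//; try exact: measurable_itv.
by move=> x /=; rewrite !in_itv/= andbT => /andP[/ltW].
Qed.

Hypothesis nojump : forall u e, 0 < e -> exists2 v, v < u & f u - f v < e.

Lemma stieltjes_set1 (u : R) : mu [set u] = 0%E.
Proof.
apply/eqP; rewrite eq_le measure_ge0 andbT; apply/lee_addgt0Pr => e e0.
rewrite add0e; have [v vu fuv] := nojump u e0.
apply: (@le_trans _ _ (mu `]v, u]%classic)).
  apply: le_measure; rewrite ?inE//; try exact: measurable_itv.
  by move=> x ->; rewrite /= in_itv/= vu lexx.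
by rewrite stieltjes_oc ?lee_fin ltW.
Qed.

Variable c : R.
Hypothesis fc : f x @[x --> +oo] --> c.

Lemma cumulative_le_terminal x : f x <= c.
Proof.
rewrite -(cvg_lim _ fc)//; apply: limr_ge; first by apply/cvg_ex; exists c.
near=> y; apply: f_nd; near: y; apply: nbhs_pinfty_ge; exact: num_real.
Unshelve. all: end_near. Qed.

Lemma stieltjes_oy (t : R) : mu `]t, +oo[%classic = (c - f t)%:E.
Proof.
pose E n := `]t, t + n%:R]%classic : set (measurableTypeR R).
have mE n : measurable (E n) by exact: measurable_itv.
have cvE : mu (E n) @[n --> \oo] --> mu `]t, +oo[%classic.
  rewrite itv_bndy_bigcup_BRight; apply: nondecreasing_cvg_mu => //.
    exact: bigcupT_measurable.
  move=> m n mn; apply/subsetPset => x; rewrite /E /= !in_itv/=.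
  by move=> /andP[-> /= /le_trans]; apply; rewrite lerD2l ler_nat.
apply: (cvg_unique _ cvE) => //=.
rewrite (_ : (fun n => _) = (fun n => (f (t + n%:R) - f t)%:E)); last first.
  by apply/funext => n; rewrite /= /E stieltjes_oc// lerDl.
apply: cvg_EFin; first by near=> n.
apply: cvgB; last exact: cvg_cst.
apply: (cvg_comp _ _ _ fc).
apply/cvgryPge => M; near=> n.
rewrite -lerBlDl; near: n; exact: nbhs_infty_ger.
Unshelve. all: end_near. Qed.

Lemma stieltjes_cy (t : R) : mu `[t, +oo[%classic = (c - f t)%:E.
Proof.
rewrite -(setU1itv false)//.
transitivity (mu [set t] + mu `]t, +oo[%classic)%E; last first.
  by rewrite stieltjes_set1 add0e stieltjes_oy.
apply: measureU; [exact: measurable_set1|exact: measurable_itv|].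
by apply/seteqP; split=> x //= -[->]; rewrite in_itv/= ltxx.
Qed.

(** The measure of a superlevel set of [f]: the set is a half-line ]r, +oo[
    where [r], the last time at which [f] is at most [x], satisfies f r = x
    because [f] is continuous. *)
Lemma stieltjes_superlevel (t x : R) :
  mu (`[t, +oo[%classic `&` [set s | x < f s]) =
  (if x < f t then c - f t else if x < c then c - x else 0)%:E.
Proof.
case: ltP => [xft|ftx].
  rewrite (_ : _ `&` _ = `[t, +oo[%classic) ?stieltjes_cy//.
  apply/seteqP; split=> s /= [] //; rewrite in_itv/= andbT => ts.
  by split=> //; exact: lt_le_trans (f_nd ts).
case: ltP => [xc|cx]; last first.
  rewrite (_ : _ `&` _ = set0) ?measure0//.
  apply/seteqP; split=> s //= -[_]; rewrite ltNge (le_trans _ cx)//.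
  exact: cumulative_le_terminal.
pose E := [set s | t <= s /\ f s <= x].
have [M xM] : exists M, x < f M.
  have /filter_ex[M xM] : \forall y \near +oo, x < f y by exact: cvgr_gt xc.
  by exists M.
have ubE : ubound E M.
  by move=> s [_ fsx]; rewrite leNgt; apply/negP => /ltW/f_nd; rewrite leNgt (le_lt_trans fsx).
have supE : has_sup E by split; [exists t|exists M].
set r := sup E.
have tr : t <= r by apply: sup_upper_bound.
have frx : f r <= x.
  apply/ler_addgt0Pr => e e0; have [v vr frv] := nojump r e0.
  have rv0 : 0 < r - v by rewrite subr_gt0.
  have [s [ts fsx]] := sup_adherent rv0 supE.
  rewrite -/r opprB addrCA subrr addr0 => vs.
  have := f_nd (ltW vs); lra.
have frE : f r = x.
  apply/eqP; rewrite eq_le frx/=; apply/ler_addgt0Pr => e e0.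
  have [h fh] := nondecreasing_right_continuousP r f e0.
  apply: le_trans fh; rewrite leNgt; apply/negP => fx.
  have : E (r + h%:num) by split; [rewrite (le_trans tr)// lerDl|exact: ltW].
  by move=> /(sup_upper_bound supE); rewrite -/r gerDl leNgt => /negP; apply.
rewrite (_ : _ `&` _ = `]r, +oo[%classic) ?stieltjes_oy ?frE//.
apply/seteqP; split=> s /=; rewrite !in_itv/= !andbT.
  move=> [ts xfs]; rewrite ltNge; apply/negP => /f_nd.
  by rewrite frE leNgt xfs.
move=> rs; split; first by rewrite (le_trans tr)// ltW.
rewrite ltNge; apply/negP => fsx.
have : E s by split=> //; rewrite (le_trans tr)// ltW.
by move=> /(sup_upper_bound supE); rewrite leNgt rs.
Qed.

(** Chain rule for a continuous increasing function: the image of df by [f] is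
    the Lebesgue measure on the range of [f], as [stieltjes_superlevel] shows
    on half-lines. *)
Lemma integral_stieltjes_comp (t : R) (g : R -> R) (M : R) :
  continuous g -> (forall x, `|g x| <= M) ->
  (\int[mu]_(s in `[t, +oo[) (g (f s))%:E =
   \int[lebesgue_measure]_(x in `[f t, c]) (g x)%:E)%E.
Proof.
move=> cg gM.
have mg : measurable_fun setT g by exact: continuous_measurable_fun.
have mf : measurable_fun setT (f : measurableTypeR R -> measurableTypeR R).
  by apply: nondecreasing_measurable => //; exact: cumulative_is_nondecreasing.
have mD : measurable (`[t, +oo[%classic : set (measurableTypeR R)) by exact: measurable_itv.
have mI : measurable (`[f t, c]%classic : set (measurableTypeR R)) by exact: measurable_itv.
have ftc : f t <= c by exact: cumulative_le_terminal.
rewrite -(@integral_mrestr _ _ _ mu _ mD (fun s => (g (f s))%:E)); last first.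
  by apply/measurable_EFinP; apply: measurableT_comp mf.
rewrite -(@integral_mrestr _ _ _ lebesgue_measure _ mI (EFin \o g)); last first.
  exact/measurable_EFinP.
have intg : (mrestr mu mD).-integrable
    (f @^-1` [set: measurableTypeR R]) ((EFin \o g) \o f).
  apply: measurable_bounded_integrable => //.
  - by rewrite preimage_setT.
  - by rewrite /= /mrestr preimage_setT setTI stieltjes_cy ltry.
  - exact: (measurableT_comp mg mf).
  - exists M; split; first exact: num_real.
    by move=> M' MM' s _ /=; exact: le_trans (gM _) (ltW MM').
have mEg : measurable_fun [set: measurableTypeR R] (EFin \o g : measurableTypeR R -> \bar R).
  exact/measurable_EFinP.
have := integral_pushforward mf mEg intg measurableT.
rewrite preimage_setT => <-.
apply: eq_measure_integral => A mA _.
apply: (@measure_unique _ R (measurableTypeR R) (@RGenOInfty.G R)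
  (fun n => `]- n%:R, +oo[%classic)) => //.
- exact: RGenOInfty.measurableE.
- move=> _ _ [x ->] [y ->]; exists (Num.max x y).
  by apply/seteqP; split=> z /=; rewrite !in_itv/= !andbT gt_max; [move=> [-> ->]|case/andP].
- by move=> n; exists (- n%:R).
- rewrite -subTset => x _; exists (Num.bound `|x|) => //=.
  rewrite in_itv/= andbT ltrNl (le_lt_trans (ler_norm _))// normrN.
  exact: archi_boundP.
- move=> _ [x ->]; rewrite /= /pushforward /mrestr.
  rewrite (_ : _ `&` _ = `[t, +oo[%classic `&` [set s | x < f s]); last first.
    by apply/seteqP; split=> s /=; rewrite !in_itv/= !andbT => -[].
  rewrite stieltjes_superlevel.
  case: ltP => [xft|ftx].
    rewrite (_ : _ `&` _ = `[f t, c]%classic); last first.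
      apply/seteqP; split=> y /=; rewrite !in_itv/= ?andbT; first by case.
      move=> /andP[ty ->]; by rewrite ty (lt_le_trans xft).
    rewrite lebesgue_measure_itv/= lte_fin; case: ltP => // h.
    have -> : c = f t by apply/eqP; rewrite eq_le h.
    by rewrite subrr.
  case: ltP => [xc|cx].
    rewrite (_ : _ `&` _ = `]x, c]%classic); last first.
      apply/seteqP; split=> y /=; rewrite !in_itv/= ?andbT.
        by move=> [-> /andP[]].
      by move=> /andP[xy ->]; rewrite xy (ltW (le_lt_trans ftx xy)).
    by rewrite lebesgue_measure_itv/= lte_fin xc.
  rewrite (_ : _ `&` _ = set0) ?measure0//.
  apply/seteqP; split=> y //=; rewrite !in_itv/= andbT => -[xy /andP[_ yc]].
  by have := lt_le_trans xy yc; rewrite ltNge cx.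
- move=> n; rewrite /= /pushforward /mrestr.
  apply: (@le_lt_trans _ _ (mu `[t, +oo[%classic)); last by rewrite stieltjes_cy ltry.
  apply: le_measure => //; rewrite ?inE//.
  apply: measurableI => //; rewrite -[X in measurable X]setTI; exact: mf.
Qed.

End stieltjes.

(** * Optional processes and stochastic intervals *)

Section optional_toolbox.
Context {R : realType} {d : measure_display} {T : measurableType d}.
Variables (P : probability T R) (F : R -> set_system T).
Hypothesis uF : usual_filtration P F.

Local Notation time_space := (@time_space d T R).

Lemma cadlagB (X Y : R -> T -> R) : cadlag X -> cadlag Y ->
  cadlag (fun s w => X s w - Y s w).
Proof.
move=> cX cY w; have [rX lX] := cX w; have [rY lY] := cY w; split=> t t0.
  by apply: cvgB; [exact: rX|exact: rY].
by apply: is_cvgB; [exact: lX|exact: lY].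
Qed.

Lemma cadlagM (X Y : R -> T -> R) : cadlag X -> cadlag Y ->
  cadlag (fun s w => X s w * Y s w).
Proof.
move=> cX cY w; have [rX lX] := cX w; have [rY lY] := cY w; split=> t t0.
  by apply: cvgM; [exact: rX|exact: rY].
by apply: is_cvgM; [exact: lX|exact: lY].
Qed.

Lemma cadlag_continuous_comp (g : R -> R) (X : R -> T -> R) :
  continuous g -> cadlag X -> cadlag (fun s w => g (X s w)).
Proof.
move=> cg cX w; have [rX lX] := cX w; split=> t t0.
  by apply: (cvg_comp _ _ (rX t t0)); exact: cg.
have /cvg_ex[l Xl] := lX t t0; apply/cvg_ex; exists (g l).
by apply: (cvg_comp _ _ Xl); exact: cg.
Qed.

Lemma cadlag_cumulative_shift (A : T -> cumulative R R) (h : R) :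
  cadlag (fun s w => A w (s - h)).
Proof.
move=> w; split=> t t0.
  apply/cvg_at_rightP => u [tu ut].
  have /cvg_at_rightP := cumulative_is_right_continuous (A w) (t - h).
  apply; split; first by move=> n; rewrite ltrD2r.
  by apply: cvgB => //; exact: cvg_cst.
apply: nondecreasing_at_left_is_cvgr.
  near=> x => y z _ _ yz; apply: cumulative_is_nondecreasing.
  by rewrite lerD2r.
near=> x; exists (A w (t - h)) => _ [y /= + <-].
rewrite in_itv/= => /andP[_ yt]; apply: cumulative_is_nondecreasing.
by rewrite lerD2r ltW.
Unshelve. all: end_near. Qed.

Lemma cadlag_cumulative (A : T -> cumulative R R) : cadlag (fun s w => A w s).
Proof.
rewrite (_ : (fun s w => _) = fun s w => A w (s - 0)).
  exact: cadlag_cumulative_shift.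
by apply/funext => s; apply/funext => w; rewrite subr0.
Qed.

Lemma cadlag_id : cadlag (fun (s : R) (_ : T) => s).
Proof.
move=> w; split=> t t0; first exact: cvg_at_right_filter.
by apply/cvg_ex; exists t; exact: cvg_at_left_filter.
Qed.

Lemma cadlag_indic_after (c : T -> \bar R) :
  cadlag (fun s w => ((c w <= s%:E)%E)%:R : R).
Proof.
move=> w; split=> t t0.
  have [ct|tc] := leP (c w) t%:E.
    apply: cvg_near_cst; near=> s.
    rewrite (@le_trans _ _ t%:E)// lee_fin ltW//; near: s; exact: nbhs_right_gt.
  have [r rc tr] : exists2 r, (r%:E <= c w)%E & t < r.
    case: (c w) tc => [r| |//]; first by rewrite lte_fin; exists r.
    by exists (t + 1); rewrite ?leey// ltrDl.
  apply: cvg_near_cst; near=> s.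
  rewrite leNgt (@lt_le_trans _ _ r%:E)// lte_fin; near: s.
  exact: nbhs_right_lt.
have [ct|tc] := ltP (c w) t%:E; apply/cvg_ex.
  have [r cr rt] : exists2 r, (c w <= r%:E)%E & r < t.
    case: (c w) ct => [r|//|]; first by rewrite lte_fin; exists r.
    by exists (t - 1); rewrite ?leNye// ltrBlDr ltrDl.
  exists 1; apply: cvg_near_cst; near=> s.
  rewrite (@le_trans _ _ r%:E)// lee_fin ltW//; near: s; exact: nbhs_left_gt.
exists 0; apply: cvg_near_cst; near=> s.
rewrite leNgt (@lt_le_trans _ _ t%:E)// lte_fin; near: s; exact: nbhs_left_lt.
Unshelve. all: end_near. Qed.

Lemma adapted_cst (g : R -> R) : adapted F (fun s (_ : T) => g s).
Proof.
move=> s s0; apply/(measurable_wrtP (filtration_sigma uF s0)).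
exact: measurable_cst.
Qed.

Lemma adapted_binop (op : R -> R -> R) (X Y : R -> T -> R) :
  (forall d' (U : measurableType d') (f g : U -> R), measurable_fun setT f ->
     measurable_fun setT g -> measurable_fun setT (fun x => op (f x) (g x))) ->
  adapted F X -> adapted F Y -> adapted F (fun s w => op (X s w) (Y s w)).
Proof.
move=> mop aX aY s s0; have sF := filtration_sigma uF s0.
apply/(measurable_wrtP sF).
by apply: mop; apply/(measurable_wrtP sF); [exact: aX|exact: aY].
Qed.

Lemma adaptedB (X Y : R -> T -> R) :
  adapted F X -> adapted F Y -> adapted F (fun s w => X s w - Y s w).
Proof.
by apply: (@adapted_binop (fun x y => x - y)) => *; exact: measurable_funB.
Qed.

Lemma adaptedM (X Y : R -> T -> R) :
  adapted F X -> adapted F Y -> adapted F (fun s w => X s w * Y s w).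
Proof.
by apply: (@adapted_binop (fun x y => x * y)) => *; exact: measurable_funM.
Qed.

Lemma adapted_continuous_comp (g : R -> R) (X : R -> T -> R) :
  continuous g -> adapted F X -> adapted F (fun s w => g (X s w)).
Proof.
move=> cg aX s s0; have sF := filtration_sigma uF s0.
apply/(measurable_wrtP sF); apply: measurableT_comp.
  exact: continuous_measurable_fun.
by apply/(measurable_wrtP sF); exact: aX.
Qed.

Lemma measurable_wrt_indic (G : set_system T) (b : T -> bool) :
  sigma_algebra setT G -> G [set w | b w] ->
  measurable_wrt setT G (fun w => (b w)%:R : R).
Proof.
move=> sG Gb; apply/(measurable_wrtP sG).
rewrite (_ : (fun w => _) = \1_[set w | b w]); last first.
  apply/funext => w; rewrite indicE; congr ((nat_of_bool _)%:R).
  by apply/idP/idP; rewrite inE.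
by apply: measurable_indic; apply/measurable_sub_sigma_algebra.
Qed.

Lemma adapted_indic_after (tau : T -> \bar R) (r : R) : 0 <= r ->
  stopping_time F tau ->
  adapted F (fun s w => ((tau w + r%:E <= s%:E)%E)%:R).
Proof.
move=> r0 [tau0 Ftau] s s0; have sF := filtration_sigma uF s0.
apply: measurable_wrt_indic => //.
have [rs|sr] := leP r s.
  rewrite (_ : mkset _ = [set w | (tau w <= (s - r)%:E)%E]).
    have sr0 : 0 <= s - r by rewrite subr_ge0.
    apply: (filtration_nondecreasing uF sr0) (Ftau _ sr0).
    by rewrite gerBl.
  by apply/seteqP; split=> w /=; rewrite EFinB leeBrDr.
rewrite (_ : mkset _ = set0); first by case: sF.
apply/seteqP; split=> w //=; rewrite leNgt => /negP; apply.
by rewrite (@lt_le_trans _ _ r%:E)// leeDr.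
Qed.

Lemma stopping_time_cst (q : R) : 0 <= q -> stopping_time F (fun=> q%:E).
Proof.
move=> q0; split=> [w|t t0]; first by rewrite lee_fin.
have sF := filtration_sigma uF t0.
have [qt|tq] := leP q t.
  rewrite (_ : mkset _ = setT); first exact: salgT.
  by apply/seteqP; split=> w //= _; rewrite lee_fin.
rewrite (_ : mkset _ = set0); first by case: sF.
by apply/seteqP; split=> w //=; rewrite lee_fin leNgt tq.
Qed.

Lemma optional_adapted_cadlag (X : R -> T -> R) :
  adapted F X -> cadlag X -> optional_process F X.
Proof.
move=> aX cX S XS; apply: sub_sigma_algebra.
by exists X.
Qed.

Lemma optional_preimage (X : R -> T -> R) (Y : set R) :
  adapted F X -> cadlag X -> measurable Y ->
  optional F (time_space `&` (fun p => X p.1 p.2) @^-1` Y).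
Proof. by move=> aX cX mY; apply: (optional_adapted_cadlag aX cX); exists Y. Qed.

Lemma optionalD (S : set (R * T)) : optional F S -> optional F (time_space `\` S).
Proof. exact: sigma_algebraCD. Qed.

Lemma optional_bigcup (S : nat -> set (R * T)) :
  (forall n, optional F (S n)) -> optional F (\bigcup_n S n).
Proof. exact: sigma_algebra_bigcup. Qed.

Lemma optional_bigcap (S : nat -> set (R * T)) :
  (forall n, optional F (S n)) -> optional F (\bigcap_n S n).
Proof.
move=> oS; rewrite (_ : \bigcap_n _ = time_space `\` \bigcup_n (time_space `\` S n)).
  by apply: optionalD; apply: optional_bigcup => n; exact: optionalD.
apply/seteqP; split=> x.
  move=> Sx; split; last by case=> n _ [_]; apply; exact: Sx.
  exact: (optional_time_space (oS 0%N) (Sx 0%N Logic.I)).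
by move=> [Dx nS] n _; apply: contrapT => nSx; apply: nS; exists n.
Qed.

Lemma optionalI (S S' : set (R * T)) :
  optional F S -> optional F S' -> optional F (S `&` S').
Proof.
move=> oS oS'; rewrite (_ : _ `&` _ = \bigcap_n (if n is 0%N then S else S')).
  by apply: optional_bigcap => -[].
apply/seteqP; split=> x; first by case=> Sx Sx' [].
by move=> h; split; [exact: (h 0%N)|exact: (h 1%N)].
Qed.

Lemma optional_after (tau : T -> \bar R) (r : R) : 0 <= r ->
  stopping_time F tau ->
  optional F [set p | 0 <= p.1 /\ (tau p.2 + r%:E <= p.1%:E)%E].
Proof.
move=> r0 st; have := optional_preimage (adapted_indic_after r0 st)
  (@cadlag_indic_after (fun w => tau w + r%:E)%E) (measurable_set1 (1 : R)).
congr (optional F _); apply/seteqP; split=> -[s w] /=.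
  move=> [[/= + _]]; rewrite in_itv/= andbT => s0.
  by case: leP => // _ /eqP; rewrite eq_sym oner_eq0.
by move=> [s0 ->]; split=> //; split=> //=; rewrite in_itv/= s0.
Qed.

Lemma optional_stochastic_interval (q : R) (tau : T -> \bar R) : 0 <= q ->
  stopping_time F tau ->
  optional F [set p | q <= p.1 /\ (p.1%:E < tau p.2)%E].
Proof.
move=> q0 st.
have /= o1 := optional_after (lexx 0) (stopping_time_cst q0).
have /= o2 := optional_after (lexx 0) st.
have := optionalI o1 (optionalD o2).
congr (optional F _); apply/seteqP; split=> -[s w] /=; rewrite !adde0.
  move=> [[s0 qs] [_ ts]]; split; first by rewrite -lee_fin.
  by rewrite ltNge; apply/negP => ?; apply: ts.
move=> [qs st']; rewrite lee_fin qs (le_trans q0 qs); split=> //; split.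
  by split=> //=; rewrite in_itv/= (le_trans q0 qs).
by case=> _; rewrite leNgt st'.
Qed.

(** The graph is cut out of [tau, +oo[ by the complements of the intervals
    [tau + 1/n, +oo[, which are adapted because tau + 1/n is announced by
    [tau]. *)
Lemma optional_graph (tau : T -> \bar R) : stopping_time F tau ->
  optional F [set p | tau p.2 = p.1%:E].
Proof.
move=> st; have /= o1 := optional_after (lexx 0) st.
have n0 n : 0 <= n.+1%:R^-1 :> R by rewrite invr_ge0.
have /= o2 n := optional_after (n0 n) st.
have := optionalI o1 (optional_bigcap (fun n => optionalD (o2 n))).
congr (optional F _); apply/seteqP; split=> -[s w] /=.
  rewrite adde0 => -[[s0 ts] sn]; apply/eqP; rewrite eq_le ts/=.
  apply/lee_addgt0Pr => e e0.
  have [_ /=] := sn (Num.bound e^-1) Logic.I.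
  move=> /not_andP[//|/negP]; rewrite -ltNge => /ltW/le_trans; apply.
  rewrite leeD2l// lee_fin invf_ple ?posrE//.
  have h : e^-1 < (Num.bound e^-1)%:R by apply: archi_boundP; rewrite invr_ge0 ltW.
  by apply/ltW/(lt_trans h); rewrite ltr_nat.
move=> ts; have s0 : 0 <= s by rewrite -lee_fin -ts; case: st => + _; exact.
rewrite adde0 ts; split=> // n _; split.
  by split=> //=; rewrite in_itv/= s0.
by case=> _ /=; rewrite ts -EFinD lee_fin gerDl leNgt invr_gt0 ltr0n.
Qed.

Lemma optional_indic (S : set (R * T)) : optional F S ->
  optional_process F (fun s w => \1_S (s, w)).
Proof.
move=> oS _ [Y mY <-].
have oT : optional F time_space.
  by rewrite -(setD0 time_space); apply: optionalD; exact: sigma_algebra0.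
rewrite (_ : (fun p => _) = \1_S); last by apply/funext => -[].
have [Y1|Y1] := pselect (Y 1); have [Y0|Y0] := pselect (Y 0).
- rewrite (_ : _ `&` _ = time_space)//; apply/seteqP; split=> x; first by case.
  by move=> Dx; split=> //; rewrite /= indicE; case: (_ \in _).
- rewrite (_ : _ `&` _ = S)//; apply/seteqP; split=> x.
    by move=> [_]; rewrite /= indicE; case: (boolP (x \in S)) => //; rewrite inE.
  move=> Sx; split; first exact: (optional_time_space oS Sx).
  by rewrite /= indicE mem_set.
- rewrite (_ : _ `&` _ = time_space `\` S); first exact: optionalD.
  apply/seteqP; split=> x.
    move=> [Dx]; rewrite /= indicE; case: (boolP (x \in S)) => //.
    by rewrite notin_setE.
  by move=> [Dx Sx]; split=> //; rewrite /= indicE memNset.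
- rewrite (_ : _ `&` _ = set0); first exact: sigma_algebra0.
  apply/seteqP; split=> x //= -[_]; rewrite indicE.
  by case: (_ \in _).
Qed.

End optional_toolbox.

(** * Paths of the dual optional projection *)

Section cumulative_jumps.
Context {R : realType} (f : cumulative R R).

(** The times of the jumps of size at least [e]; [f] is increasing, so the jump
    at [u] is the infimum of the increments over ]u - 1/n, u]. *)
Definition jumps (e : R) : set R :=
  [set u | 0 <= u /\ forall n : nat, e <= f u - f (u - n.+1%:R^-1)].

Lemma jumps_lt e u v : jumps e u -> v < u -> e <= f u - f v.
Proof.
move=> [_ Ju] vu; apply: le_trans (Ju (Num.bound (u - v)^-1)) _.
rewrite lerB//; apply: cumulative_is_nondecreasing.
rewrite lerBrDr -lerBrDl invf_ple ?posrE ?subr_gt0//.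
have h : (u - v)^-1 < (Num.bound (u - v)^-1)%:R.
  by apply: archi_boundP; rewrite invr_ge0 subr_ge0 ltW.
by apply/ltW/(lt_trans h); rewrite ltr_nat.
Qed.

(** By right-continuity [f] grows by less than [e] just after the infimum [i]
    of the jump times, so that no jump of size [e] occurs in a right
    neighbourhood of [i]: the infimum is itself a jump time. *)
Lemma first_jump_attained e : 0 < e -> jumps e !=set0 ->
  exists2 u, jumps e u & ereal_inf [set t%:E | t in jumps e] = u%:E.
Proof.
move=> e0 J0; have lbJ : has_lbound (jumps e) by exists 0 => u [].
have infJ : has_inf (jumps e) by [].
exists (inf (jumps e)); last by rewrite ereal_inf_EFin.
have e20 : 0 < e / 2 by rewrite divr_gt0.
have [h fh] := nondecreasing_right_continuousP (inf (jumps e)) f e20.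
have [u Ju uh] : exists2 u, jumps e u & u < inf (jumps e) + h%:num.
  by have [u Ju uh] := inf_adherent [gt0 of h%:num] infJ; exists u.
have : inf (jumps e) <= u by exact: ge_inf.
rewrite le_eqVlt => /predU1P[->//|iu].
have := jumps_lt Ju iu.
have : f u <= f (inf (jumps e) + h%:num).
  by apply: cumulative_is_nondecreasing; exact: ltW.
lra.
Qed.

Lemma nojumpP : (forall v, v < 0 -> f v = 0) ->
  (forall n : nat, jumps n.+1%:R^-1 = set0) ->
  forall u e, 0 < e -> exists2 v, v < u & f u - f v < e.
Proof.
move=> f0 J0 u e e0; have [u0|u0] := leP 0 u; last first.
  exists (u - 1); first by rewrite ltrBlDr ltrDl.
  by rewrite !f0 ?subr0//; lra.
pose k := Num.bound e^-1.
have ke : k.+1%:R^-1 < e.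
  rewrite invf_plt ?posrE//.
  have h : e^-1 < k%:R by apply: archi_boundP; rewrite invr_ge0 ltW.
  by apply: (lt_trans h); rewrite ltr_nat.
have : ~ jumps k.+1%:R^-1 u by rewrite J0.
move=> /not_andP[//|/existsNP[n /negP]]; rewrite -ltNge => fn.
exists (u - n.+1%:R^-1); first by rewrite ltrBlDr ltrDl invr_gt0.
exact: lt_trans fn ke.
Qed.

End cumulative_jumps.

Section honest_times.
Context {R : realType} {d : measure_display} {T : measurableType d}.
Variables (P : probability T R) (F : R -> set_system T).
Variables (L : T -> \bar R) (A : T -> cumulative R R).
Hypotheses (uF : usual_filtration P F) (hL : honest_time P F L).
Hypotheses (avL : avoids_stopping_times P F L).
Hypothesis dL : dual_optional_projection P F L A.

Local Notation mu w := (lebesgue_stieltjes_measure (A w)).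

(** Completeness makes every function that is almost everywhere equal to a
    measurable one measurable; this settles the measurability of the terminal
    value and of the integrals along paths. *)
Lemma complete_probability : measure_is_complete P.
Proof.
apply: subset_trans (filtration_complete uF) _.
exact: (filtration_event uF (lexx 0)).
Qed.

Lemma stopping_time_measurable (tau : T -> \bar R) :
  stopping_time F tau -> measurable_fun setT tau.
Proof.
move=> [tau0 Ftau].
apply: (measurability _ (ErealGenOInfty.measurableE R)) => // _ [_ [x ->] <-].
rewrite setTI; have [x0|x0] := leP 0 x.
  rewrite (_ : _ @^-1` _ = ~` [set w | (tau w <= x%:E)%E]).
    by apply: measurableC; exact: (filtration_event uF x0) (Ftau _ x0).
  apply/seteqP; split=> w /=; rewrite in_itv/= andbT ltNge; first by move/negP.
  by move=> h; apply/negP.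
rewrite (_ : _ @^-1` _ = setT)//; apply/seteqP; split=> w //= _.
by rewrite in_itv/= andbT (@lt_le_trans _ _ 0%E)// lte_fin.
Qed.

Lemma measurable_L : measurable_fun setT L. Proof. by case: hL. Qed.

Lemma L_ge0 w : (0 <= L w)%E.
Proof.
by case: hL => _ [Gamma _ ->] _ _; apply: ereal_sup_ubound; left.
Qed.

Lemma L_fin_num w : (L w < +oo)%E -> L w \is a fin_num.
Proof. by move=> Lw; rewrite ge0_fin_numE// L_ge0. Qed.

Lemma avoids_cst (q : R) : 0 <= q -> P [set w | L w = q%:E] = 0%E.
Proof. by move=> q0; apply: (avL (stopping_time_cst uF q0)). Qed.

Lemma ae_L_fin : {ae P, forall w, (L w < +oo)%E}.
Proof.
exists [set w | L w = +oo%E]; split; last first.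
- by move=> w /= /negP; rewrite -leNgt leye_eq => /eqP.
- by case: hL.
- have := measurable_eqe measurableT measurable_L (measurable_cst +oo%E).
  by rewrite setTI.
Qed.

(** How condition (A) acts: the mean mass of dA on an optional set is the
    probability that the set is met at time [L], which is null if that can
    only happen when [L] equals a given stopping time. *)
Lemma dual_indic_null (S : set (R * T)) (tau : T -> \bar R) :
  optional F S -> stopping_time F tau ->
  (forall w, (L w < +oo)%E -> S (fine (L w), w) -> L w = tau w) ->
  (\int[P]_w \int[mu w]_(s in `[0%R, +oo[) (\1_S (s, w))%:E = 0)%E.
Proof.
move=> oS st SL; have [_ _ dual] := dL.
rewrite (dual _ (optional_indic oS)); last first.
  by exists 1 => t w _; rewrite indicE; case: (_ \in _); rewrite ?normr0 ?normr1.
have mLt : measurable [set w | L w = tau w].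
  have := measurable_eqe measurableT measurable_L (stopping_time_measurable st).
  by rewrite setTI.
apply/eqP; rewrite eq_le; apply/andP; split; last first.
  by apply: integral_ge0 => w _; rewrite lee_fin.
rewrite -(avL st) -[X in (_ <= P X)%E]setIT -integral_indic//.
rewrite [leLHS]integral_mkcond.
apply: ge0_le_integral_nonmeasurable => w; rewrite patchE.
  by case: ifPn => // _; rewrite lee_fin.
case: ifPn => [|_]; last by rewrite lee_fin.
rewrite inE/= => Lw; rewrite lee_fin !indicE ler_nat.
case: (boolP (_ \in S)) => //; rewrite inE => /(SL _ Lw) Lt.
by rewrite mem_set.
Qed.

Lemma A_adapted_shift (h : R) : 0 <= h -> adapted F (fun s w => A w (s - h)).
Proof.
have [A0 aA _] := dL; move=> h0 s s0; have sF := filtration_sigma uF s0.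
have [hs|sh] := leP h s.
  have sh0 : 0 <= s - h by rewrite subr_ge0.
  apply: subset_trans (aA _ sh0) _; apply: (filtration_nondecreasing uF) => //.
  by rewrite gerBl.
apply/(measurable_wrtP sF); rewrite (_ : (fun w => _) = cst 0).
  exact: measurable_cst.
by apply/funext => w; rewrite A0// subr_lt0.
Qed.

Lemma A_adapted : adapted F (fun s w => A w s). Proof. by case: dL. Qed.

Lemma A_neg0 w t : t < 0 -> A w t = 0. Proof. by case: dL => + _ _; exact. Qed.

Lemma optional_jumps (e : R) : optional F [set p | jumps (A p.2) e p.1].
Proof.
have n0 (n : nat) : 0 <= n.+1%:R^-1 :> R by rewrite invr_ge0.
have oJ (n : nat) := optional_preimage (adaptedB uF A_adapted (A_adapted_shift (n0 n)))
  (cadlagB (cadlag_cumulative A) (cadlag_cumulative_shift A n.+1%:R^-1))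
  (measurable_itv `[e, +oo[).
have := optional_bigcap oJ; congr (optional F _).
apply/seteqP; split=> -[s w] /=.
  move=> Jsw; split.
    by have [[/=]] := Jsw 0%N Logic.I; rewrite in_itv/= andbT.
  by move=> n; have [_ /=] := Jsw n Logic.I; rewrite in_itv/= andbT.
move=> [s0 Jsw] n _; split; first by split=> //=; rewrite in_itv/= s0.
by rewrite /= in_itv/= andbT.
Qed.

(** Apply [dual_indic_null] to the graph of the first time [tau] of a jump of
    size at least [e]: the mass that dA puts on the graph is at least [e]
    when [tau] is finite. *)
Lemma ae_jumps_set0 (e : R) : 0 < e -> {ae P, forall w, jumps (A w) e = set0}.
Proof.
move=> e0; pose S := [set p | jumps (A p.2) e p.1].
have oS : optional F S by exact: optional_jumps.
pose tau := debut S; have st : stopping_time F tau := debut_stopping_time uF oS.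
pose N := [set w | (tau w < +oo)%E].
have mN : measurable N.
  have := emeasurable_fin_num measurableT (stopping_time_measurable st).
  rewrite setTI; congr measurable; apply/seteqP; split=> w /=.
    by rewrite ge0_fin_numE//; case: st.
  by rewrite ge0_fin_numE//; case: st.
have i0 := dual_indic_null (optional_graph uF st) st
  (fun w Lw Lt => esym (etrans Lt (fineK (L_fin_num Lw)))).
have PN : P N = 0%E.
  apply/eqP; rewrite eq_le measure_ge0 andbT.
  suff : (e%:E * P N <= 0)%E by rewrite pmule_rle0// lte_fin.
  rewrite -[leRHS]i0; apply: markov_nonmeasurable => //; first exact: ltW.
    by move=> w; apply: integral_ge0 => s _; rewrite lee_fin.
  move=> w /= /ereal_inf_lt[_ [v Jv _] _].
  have [|u Ju uE] := @first_jump_attained _ (A w) e e0; first by exists v.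
  apply: (@le_trans _ _ (mu w [set u])).
    by apply: stieltjes_jump => z; exact: jumps_lt.
  under eq_integral => s _.
    rewrite (_ : \1__ _ = \1_[set u] s); last first.
      rewrite !indicE; congr ((nat_of_bool _)%:R); apply/idP/idP; rewrite !inE/=.
        by rewrite /tau/debut uE => -[].
      by move=> ->; rewrite /tau /debut uE.
    over.
  rewrite integral_indic; [|exact: measurable_itv|exact: measurable_set1].
  rewrite setIidl// => s ->; rewrite /= in_itv/= andbT.
  by case: Ju.
exists N; split => // w /= /eqP/set0P[u Ju].
by apply: (@le_lt_trans _ _ u%:E); [apply: ereal_inf_lbound; exists u|rewrite ltry].
Qed.

Lemma ae_nojump : {ae P, forall w u e, 0 < e -> exists2 v, v < u & A w u - A w v < e}.
Proof.
have J0 (n : nat) : {ae P, forall w, jumps (A w) n.+1%:R^-1 = set0}.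
  by apply: ae_jumps_set0; rewrite invr_gt0.
have := ae_foralln J0; apply: filterS => w Jw u e.
by apply: nojumpP => // v; exact: A_neg0.
Qed.

(** If [tau] is the first point of [Gamma] after [q], then q <= L < tau forces
    L = q, since [L] is the supremum of the section of [Gamma]; hence dA does
    not charge [q, tau[. On the event L <= q nothing of [Gamma] is left after
    [q], so tau = +oo and the path is constant after [q]. *)
Lemma ae_flat_after_rat (q : R) : 0 <= q ->
  {ae P, forall w, (L w <= q%:E)%E -> forall n : nat, A w (q + n%:R) = A w q}.
Proof.
move=> q0; have [_ [Gamma oG LE] _ _] := hL.
pose G' := Gamma `&` (@time_space d T R `&` (fun p => p.1) @^-1` `]q, +oo[%classic).
have oG' : optional F G'.
  apply: optionalI => //.
  have := optional_preimage (adapted_cst uF (g := fun s => s)) (@cadlag_id R d T)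
    (measurable_itv `]q, +oo[).
  done.
pose tau := debut G'; have st : stopping_time F tau := debut_stopping_time uF oG'.
have SL w : (L w < +oo)%E -> [set p | q <= p.1 /\ (p.1%:E < tau p.2)%E] (fine (L w), w) ->
    L w = q%:E.
  move=> /L_fin_num fL [/= qL Ltau]; rewrite fineK// in Ltau.
  apply/eqP; rewrite eq_le; apply/andP; split; last by rewrite -(fineK fL) lee_fin.
  rewrite leNgt; apply/negP; rewrite {1}LE => /ereal_sup_gt[_ [->|[u Gu <-]] qu].
    by move: qu; rewrite lte_fin ltNge q0.
  move: Ltau; rewrite ltNge => /negP; apply.
  apply: (@le_trans _ _ u%:E).
    apply: ereal_inf_lbound; exists u => //; split=> //; split=> /=.
      by split=> //=; rewrite in_itv/= andbT (le_trans q0)// ltW// -lte_fin.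
    by rewrite in_itv/= andbT -lte_fin.
  by rewrite LE; apply: ereal_sup_ubound; right; exists u.
have i0 := dual_indic_null (optional_stochastic_interval uF q0 st)
  (stopping_time_cst uF q0) SL.
have tauE w : (L w <= q%:E)%E -> tau w = +oo%E.
  move=> Lq; rewrite /tau /debut (_ : [set _ | _ in _] = set0) ?ereal_inf0//.
  apply/seteqP; split=> // x [u [Gu [_ /= +]] _]; rewrite in_itv/= andbT => qu.
  have : (u%:E <= L w)%E by rewrite LE; apply: ereal_sup_ubound; right; exists u.
  by move=> /le_trans /(_ Lq); rewrite lee_fin leNgt qu.
have mA s : 0 <= s -> measurable_fun setT (fun w => A w s).
  move=> s0 _ Y mY; apply: (filtration_event uF s0).
  by apply: (A_adapted s0); exists Y.
suff : {ae P, forall w n, (L w <= q%:E)%E -> A w (q + n%:R) = A w q}.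
  by apply: filterS => w h Lw n; exact: h.
apply: ae_foralln => n.
pose N k := [set w | (L w <= q%:E)%E] `&` [set w | k.+1%:R^-1 <= A w (q + n%:R) - A w q].
have mN k : measurable (N k).
  apply: measurableI.
    have := measurable_lee measurableT measurable_L (measurable_cst q%:E).
    by rewrite setTI.
  have := measurable_fun_le measurableT (measurable_cst (k.+1%:R^-1 : R))
    (measurable_funB (mA (q + n%:R) (addr_ge0 q0 (ler0n _ _))) (mA q q0)).
  by rewrite setTI.
have PN k : P (N k) = 0%E.
  apply/eqP; rewrite eq_le measure_ge0 andbT.
  have k0 : 0 < k.+1%:R^-1 :> R by rewrite invr_gt0.
  suff : ((k.+1%:R^-1)%:E * P (N k) <= 0)%E by rewrite pmule_rle0// lte_fin.
  rewrite -[leRHS]i0; apply: markov_nonmeasurable => //.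
    by move=> w; apply: integral_ge0 => s _; rewrite lee_fin.
  move=> w [/= Lq Ak]; rewrite -lee_fin in Ak; apply: (le_trans Ak).
  apply: (le_trans (stieltjes_co_ge _ _)); first by rewrite lerDl.
  under eq_integral => s _.
    rewrite (_ : \1__ _ = \1_`[q, +oo[ s); last first.
      rewrite !indicE; congr ((nat_of_bool _)%:R); apply/idP/idP; rewrite !inE/=.
        by case=> qs _; rewrite in_itv/= qs.
      by rewrite in_itv/= andbT tauE// ltry.
    over.
  rewrite integral_indic; [|exact: measurable_itv|exact: measurable_itv].
  rewrite setIidl// => s; rewrite /= !in_itv/= !andbT; exact: le_trans.
apply: (negligibleS _ (negligible_bigcup (fun k => (negligibleP P (mN k)).2 (PN k)))).
move=> w /not_implyP[Lq /eqP Aq].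
have Aq0 : 0 < A w (q + n%:R) - A w q.
  rewrite subr_gt0 lt_neqAle eq_sym Aq; apply: cumulative_is_nondecreasing.
  by rewrite lerDl.
exists (Num.bound (A w (q + n%:R) - A w q)^-1) => //; split=> //=.
rewrite invf_ple ?posrE//.
set x := _^-1; have h : x < (Num.bound x)%:R.
  by apply: archi_boundP; rewrite invr_ge0 ltW.
by apply/ltW/(lt_trans h); rewrite ltr_nat.
Qed.

End honest_times.

(** * The duality identity along regular paths *)

Section regular_paths.
Context {R : realType} {d : measure_display} {T : measurableType d}.
Variables (P : probability T R) (F : R -> set_system T).
Variables (L : T -> \bar R) (A : T -> cumulative R R).
Hypotheses (uF : usual_filtration P F) (hL : honest_time P F L).
Hypotheses (avL : avoids_stopping_times P F L).
Hypothesis dL : dual_optional_projection P F L A.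

Local Notation mu w := (lebesgue_stieltjes_measure (A w)).

(** The outcomes at which the path of [A] is continuous and stops increasing at
    time [L]; in particular A_L is the terminal value. *)
Record regular (w : T) : Prop := Regular {
  regular_fin : (L w < +oo)%E;
  regular_nojump : forall u e, 0 < e -> exists2 v, v < u & A w u - A w v < e;
  regular_cvg : A w t @[t --> +oo] --> terminal A w;
  regular_flat : forall x, (L w <= x%:E)%E -> A w x = terminal A w }.

(** A path that is constant after every rational time following [L] is constant
    from [L] on, by right-continuity. *)
Lemma ae_regular : {ae P, forall w, regular w}.
Proof.
pose r (n : nat) : R := if unpickle n is Some q then ratr q else 0.
have flat n : {ae P, forall w, 0 <= r n -> (L w <= (r n)%:E)%E ->
    forall k : nat, A w (r n + k%:R) = A w (r n)}.
  have [r0|r0] := leP 0 (r n); last by apply: aeW => w.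
  by have := ae_flat_after_rat uF hL avL dL r0; apply: filterS => w h _.
have := ae_L_fin hL; have := ae_nojump uF hL avL dL; have := ae_foralln flat.
apply: filterS3 => w flatw njw Lw.
have fL := L_fin_num hL Lw.
have L0 : 0 <= fine (L w) by rewrite fine_ge0// (L_ge0 hL).
have nd x y : x <= y -> A w x <= A w y by exact: cumulative_is_nondecreasing.
have AL x : (L w <= x%:E)%E -> A w x = A w (fine (L w)).
  rewrite -{1}(fineK fL) lee_fin => Lx; apply/eqP; rewrite eq_le; apply/andP.
  split; last exact: nd.
  apply/ler_addgt0Pr => e e0.
  have [h fh] := nondecreasing_right_continuousP (fine (L w)) (A w) e0.
  have /rat_in_itvoo[q] : fine (L w) < fine (L w) + h%:num by rewrite ltrDl.
  rewrite in_itv/= => /andP[Lq qh].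
  have rq : r (pickle q) = ratr q by rewrite /r pickleK.
  have := flatw (pickle q); rewrite rq => /(_ (ltW (le_lt_trans L0 Lq))).
  rewrite -{1}(fineK fL) lee_fin => /(_ (ltW Lq) (Num.bound `|x|)) Aq.
  apply: le_trans fh; apply: le_trans (nd _ _ (ltW qh)); rewrite -Aq; apply: nd.
  rewrite (le_trans (ler_norm x))// (@le_trans _ _ (Num.bound `|x|)%:R)//.
    by apply/ltW/archi_boundP.
  by rewrite lerDr (le_trans L0)// ltW.
have cvA : A w t @[t --> +oo] --> A w (fine (L w)).
  apply: cvg_near_cst; near=> x; apply: AL; rewrite -(fineK fL) lee_fin.
  near: x; apply: nbhs_pinfty_ge; exact: num_real.
have tE : terminal A w = A w (fine (L w)) by exact: cvg_lim cvA.
split=> //; first by rewrite tE.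
by move=> x Lx; rewrite tE AL.
Unshelve. all: end_near. Qed.

Lemma ae_complete_measurable (f g : T -> R) : measurable_fun setT f ->
  {ae P, forall w, f w = g w} -> measurable_fun setT g.
Proof.
move=> mf fg; apply/measurable_EFinP.
apply: (ae_measurable_fun (complete_probability uF) (f := EFin \o f)).
  by apply: filterS fg => w /= ->.
exact/measurable_EFinP.
Qed.

Lemma A_measurable s : 0 <= s -> measurable_fun setT (fun w => A w s).
Proof.
move=> s0 _ Y mY; apply: (filtration_event uF s0).
by apply: (A_adapted dL s0); exists Y.
Qed.

Lemma terminal_measurable : measurable_fun setT (terminal A).
Proof.
have [N [mN PN NA]] := ae_regular.
have regN w : ~ N w -> regular w by move=> Nw; apply: contrapT => /NA.
pose h (n : nat) (w : T) := \1_(~` N) w * A w n%:R.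
have mh n : measurable_fun setT (h n).
  apply: measurable_funM; first by apply: measurable_indic; exact: measurableC.
  exact: A_measurable.
apply: (@ae_complete_measurable (fun w => \1_(~` N) w * terminal A w)).
  apply: (measurable_fun_cvg (h := h)) => // w _.
  have [Nw|Nw] := pselect (N w).
    rewrite /h indicE memNset ?mul0r; last by apply.
    by under eq_fun do rewrite mul0r; exact: cvg_cst.
  rewrite /h indicE mem_set// mul1r; under eq_fun do rewrite mul1r.
  have := regular_cvg (regN _ Nw).
  by move=> /(cvg_comp (fun n : nat => n%:R) _ _); apply; exact: cvgr_idn.
exists N; split=> // w; apply: contra_notP => Nw.
by rewrite /= indicE mem_set// mul1r.
Qed.

Lemma regular_A_le w s : regular w -> A w s <= terminal A w.
Proof. by move=> rw; exact: cumulative_le_terminal (regular_cvg rw) s. Qed.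

Lemma A_ge0 w s : 0 <= A w s.
Proof.
have -> : 0 = A w (Num.min s 0 - 1).
  by rewrite (A_neg0 dL)// subr_lt0 (@le_lt_trans _ _ 0)// ge_min lexx orbT.
apply: cumulative_is_nondecreasing; rewrite lerBlDr ge_min.
by rewrite lerDl ler01.
Qed.

Lemma regular_A0 w : regular w -> A w 0 = 0.
Proof.
move=> rw; apply/eqP; rewrite eq_le A_ge0 andbT.
apply/ler_addgt0Pr => e e0; have [v v0] := regular_nojump rw 0 e0.
by rewrite (A_neg0 dL w v0) subr0 add0r => /ltW.
Qed.

(** The stopping time t restricted to the event [B] of the past; its indicator
    process is 1_B 1_[t, +oo[. *)
Lemma stopping_time_restrict (B : set T) t : 0 <= t -> F t B ->
  stopping_time F (fun w => if w \in B then t%:E else +oo%E).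
Proof.
move=> t0 FB; split=> [w|s s0]; first by case: ifP => _; rewrite ?leey ?lee_fin.
have sF := filtration_sigma uF s0.
have [ts|st] := leP t s.
  rewrite (_ : mkset _ = B); first exact: (filtration_nondecreasing uF t0 ts).
  apply/seteqP; split=> w /=; last by move=> Bw; rewrite mem_set// lee_fin.
  by case: ifPn => [/set_mem//|_]; rewrite leNgt ltry.
rewrite (_ : mkset _ = set0); first by case: sF.
apply/seteqP; split=> w //=; case: ifPn => _; last by rewrite leNgt ltry.
by rewrite lee_fin leNgt st.
Qed.

(** The defining identity of the dual optional projection for the optional
    process H_s = 1_B 1_(t <= s) g(A_s). Along a regular path its integral
    against dA is G(A_oo) - G(A_t) by the chain rule, and its value at time [L]
    is 1_(t < L) g(A_oo). *)
Lemma dual_chain_rule (G g : R -> R) (M : R) (B : set T) (t : R) :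
  continuous g -> (forall x, `|g x| <= M) -> measurable_fun setT G ->
  (forall a b, a <= b ->
     (\int[lebesgue_measure]_(x in `[a, b]) (g x)%:E = (G b - G a)%:E)%E) ->
  0 <= t -> F t B ->
  (\int[P]_w (\1_B w * (G (terminal A w) - G (A w t)))%:E =
   \int[P]_w (\1_B w * (\1_[set w | (t%:E < L w)%E] w * g (terminal A w)))%:E)%E.
Proof.
move=> cg gM mG gG t0 FB.
have mB : measurable B by exact: (filtration_event uF t0).
have mg : measurable_fun setT g by exact: continuous_measurable_fun.
pose tB w := if w \in B then t%:E else +oo%E.
have st : stopping_time F tB by exact: stopping_time_restrict.
pose H s w := ((tB w + 0%:E <= s%:E)%E)%:R * g (A w s).
have oH : optional_process F H.
  apply: optional_adapted_cadlag.
    apply: (adaptedM uF (X := fun s w => ((tB w + 0%:E <= s%:E)%E)%:R)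
      (Y := fun s w => g (A w s))).
      exact: (adapted_indic_after uF (lexx 0) st).
    exact: (adapted_continuous_comp uF (X := fun s w => A w s) cg (A_adapted dL)).
  apply: (cadlagM (X := fun s w => ((tB w + 0%:E <= s%:E)%E)%:R)
    (Y := fun s w => g (A w s))).
    exact: (cadlag_indic_after (fun w => tB w + 0%:E)%E).
  exact: (cadlag_continuous_comp (X := fun s w => A w s) cg (cadlag_cumulative A)).
have [_ _ /(_ _ oH)] := dL.
have bH : exists M, forall s w, 0 <= s -> `|H s w| <= M.
  exists M => s w _; rewrite /H; case: (_ <= _)%E; rewrite ?mul1r// mul0r normr0.
  by rewrite (le_trans _ (gM 0)).
move=> /(_ bH).
rewrite [X in _ = X -> _]integral_mkcond.
have mtL : measurable [set w | (t%:E < L w)%E].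
  have := measurable_lte measurableT (measurable_cst t%:E) (measurable_L hL).
  by rewrite setTI.
have mL1 : measurable_fun setT (fun w => (\1_B w * (G (terminal A w) - G (A w t)))%:E).
  apply/measurable_EFinP/measurable_funM; first exact: measurable_indic.
  apply: measurable_funB; first exact: measurableT_comp terminal_measurable.
  exact: measurableT_comp (A_measurable t0).
have mR1 : measurable_fun setT
    (fun w => (\1_B w * (\1_[set w | (t%:E < L w)%E] w * g (terminal A w)))%:E).
  apply/measurable_EFinP/measurable_funM; first exact: measurable_indic.
  apply: measurable_funM; first exact: measurable_indic.
  exact: measurableT_comp terminal_measurable.
set f1 := (X in integral _ _ X = _ -> _); set f2 := (X in _ = integral _ _ X -> _).
have aL : ae_eq P setT (fun w => (\1_B w * (G (terminal A w) - G (A w t)))%:E) f1.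
  apply: filterS ae_regular => w rw _; rewrite /f1 indicE.
  have [Bw|Bw] := boolP (w \in B).
    rewrite mul1r -gG ?regular_A_le//.
    rewrite -(integral_stieltjes_comp (regular_nojump rw) (regular_cvg rw) t cg gM).
    rewrite (_ : `[t, +oo[%classic = `[0, +oo[%classic `&` `[t, +oo[%classic :> set R).
      rewrite integral_mkcondr; apply: eq_integral => s _; rewrite patchE /H.
      rewrite /tB Bw adde0 lee_fin.
      case: ifPn; first by rewrite inE/= in_itv/= andbT => ->; rewrite mul1r.
      rewrite notin_setE/= in_itv/= andbT => /negP/negbTE ->.
      by rewrite mul0r.
    rewrite setIidr// => s; rewrite /= !in_itv/= !andbT; exact: le_trans.
  rewrite mul0r integral0_eq// => s _; rewrite /H /tB (negbTE Bw) adde0.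
  by rewrite leNgt ltry mul0r.
have aR : ae_eq P setT
    (fun w => (\1_B w * (\1_[set w | (t%:E < L w)%E] w * g (terminal A w)))%:E) f2.
  have Lt : {ae P, forall w, L w != t%:E}.
    exists [set w | L w = t%:E]; split.
    - have := measurable_eqe measurableT (measurable_L hL) (measurable_cst t%:E).
      by rewrite setTI.
    - exact: (avoids_cst uF avL t0).
    - by move=> w /= /negP; rewrite negbK => /eqP.
  apply: filterS2 ae_regular Lt => w rw Lwt _; rewrite /f2 patchE mem_set/=; last first.
    exact: regular_fin rw.
  have fL := L_fin_num hL (regular_fin rw).
  rewrite /H fineK// adde0 -(regular_flat rw (x := fine (L w))) ?fineK//.
  rewrite mulrA !indicE /tB; congr (_ * _)%:E.
  have [Bw|Bw] := boolP (w \in B); last by rewrite mul0r leNgt (regular_fin rw).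
  rewrite mul1r; congr ((nat_of_bool _)%:R).
  rewrite le_eqVlt eq_sym (negbTE Lwt)/=.
  by apply/idP/idP; rewrite inE.
have cP := complete_probability uF.
rewrite -(ae_eq_integral _ _ measurableT mL1 (ae_measurable_fun cP aL mL1) aL).
by rewrite -(ae_eq_integral _ _ measurableT mR1 (ae_measurable_fun cP aR mR1) aR).
Qed.

End regular_paths.

(** * Conditioning on the past *)

Section pull_out.
Context {R : realType} {d : measure_display} {T : measurableType d}.
Variables (P : probability T R) (G : set_system T).
Hypotheses (sG : sigma_algebra setT G) (GT : G `<=` @measurable d T).

Lemma bounded_integrable (f : T -> R) (M : R) : measurable_fun setT f ->
  (forall w, `|f w| <= M) -> P.-integrable setT (EFin \o f).
Proof.
move=> mf fM; apply: measurable_bounded_integrable => //.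
  exact: (le_lt_trans (probability_le1 P measurableT) (ltry 1)).
exists M; split; first exact: num_real.
by move=> M' MM' s _ /=; exact: le_trans (fM _) (ltW MM').
Qed.

Lemma measurable_wrt_measurable (f : T -> R) :
  measurable_wrt setT G f -> measurable_fun setT f.
Proof. by move=> mf _ Y mY; apply/GT/mf; exists Y. Qed.

(** A variable with zero mean on every event of [G] has zero mean against every
    bounded [G]-measurable weight: round the weight down to a multiple of
    1/(n+1), which makes it a combination of indicators of events of [G]. *)
Lemma integral_pull_out0 (U W : T -> R) (M : R) :
  P.-integrable setT (EFin \o U) ->
  (forall B, G B -> (\int[P]_(w in B) (U w)%:E = 0)%E) ->
  measurable_wrt setT G W -> (forall w, `|W w| <= M) ->
  (\int[P]_w (W w * U w)%:E = 0)%E.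
Proof.
move=> iU U0 mW WM.
have mWT := measurable_wrt_measurable mW.
have mU : measurable_fun setT U by exact/measurable_EFinP/(measurable_int P).
have WM0 w : 0 <= W w + M.
  by have := WM w; rewrite ler_norml => /andP[+ _]; lra.
have iWU (V : T -> R) (N : R) : measurable_fun setT V -> (forall w, `|V w| <= N) ->
    P.-integrable setT (fun w => (V w * U w)%:E).
  move=> mV VN; apply: (integrableMr measurableT mV _ iU).
  exists N; split; first exact: num_real.
  by move=> N' NN' s _ /=; exact: le_trans (VN _) (ltW NN').
pose idx (n : nat) w := Num.truncn (n.+1%:R * (W w + M)).
pose c (n i : nat) : R := i%:R / n.+1%:R - M.
have idxP n w : c n (idx n w) <= W w < c n (idx n w) + n.+1%:R^-1.
  have /andP[lo hi] := truncn_itv (mulr_ge0 (ler0n R n.+1) (WM0 w)).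
  have {}lo : (idx n w)%:R / n.+1%:R <= W w + M by rewrite ler_pdivrMr// mulrC.
  have {}hi : W w + M < (idx n w)%:R / n.+1%:R + n.+1%:R^-1.
    rewrite (_ : _ + n.+1%:R^-1 = (idx n w).+1%:R / n.+1%:R).
      by rewrite ltr_pdivlMr// mulrC.
    by rewrite -[(idx n w).+1%:R]natr1 mulrDl mul1r.
  rewrite /c; move: lo hi; move: (_ / _) => x; move: (_^-1) => y lo hi.
  by apply/andP; split; lra.
have GB n i : G [set w | idx n w = i].
  have h (b : R) : G (W @^-1` `[b, +oo[%classic).
    by apply: mW; exists `[b, +oo[%classic => //; rewrite setTI.
  rewrite (_ : mkset _ = W @^-1` `[c n i, +oo[%classic `&`
      ~` (W @^-1` `[c n i.+1, +oo[%classic)).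
    by apply: salgI => //; apply: salgC.
  apply/seteqP; split=> w /=; rewrite !in_itv/= !andbT.
    move=> <-; have /andP[-> +] := idxP n w; split=> //; apply/negP.
    by rewrite -ltNge /c -[(idx n w).+1%:R]natr1 mulrDl mul1r addrAC.
  rewrite /c => -[ci /negP]; rewrite -ltNge => cS; apply/eqP.
  rewrite truncn_eq; last by rewrite mulr_ge0.
  rewrite mulrC -ler_pdivrMr// -ltr_pdivlMr//.
  by move: ci cS; move: (_ / _) => x; move: (_ / _) => y ci cS; apply/andP; split; lra.
pose K n := Num.bound (n.+1%:R * (M + M)).
have idxK n w : (idx n w < K n)%N.
  rewrite -(ltr_nat R); apply: (@le_lt_trans _ _ (n.+1%:R * (M + M))).
    apply: (@le_trans _ _ (n.+1%:R * (W w + M))).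
      by rewrite truncn_le mulr_ge0.
    by rewrite ler_pM2l// lerD2r (le_trans (ler_norm _)).
  have M0 : 0 <= M by rewrite (le_trans _ (WM w)).
  by apply: archi_boundP; rewrite mulr_ge0// addr_ge0.
pose Wn n w := c n (idx n w).
have mB n i : measurable [set w | idx n w = i] by exact: GT.
have WnE n w : (Wn n w * U w)%:E =
    (\sum_(i < K n) (c n i)%:E * (\1_[set w | idx n w = i] w * U w)%:E)%E.
  rewrite (bigD1 (Ordinal (idxK n w)))//= big1 ?adde0.
    by rewrite indicE mem_set// mul1r.
  move=> i ni; rewrite indicE memNset ?mul0r ?mule0//= => iE.
  by move/eqP: ni; apply; apply: val_inj; rewrite /= iE.
have iB n i : P.-integrable setT (fun w => (\1_[set w | idx n w = i] w * U w)%:E).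
  apply: (iWU _ 1); first exact: measurable_indic.
  by move=> w; rewrite indicE; case: (_ \in _); rewrite ?normr1 ?normr0.
have iWn n : P.-integrable setT (fun w => (Wn n w * U w)%:E).
  under eq_fun do rewrite WnE.
  by apply: integrable_sum => // i _; exact: integrableZl.
have Wn0 n : (\int[P]_w (Wn n w * U w)%:E = 0)%E.
  under eq_integral do rewrite WnE.
  rewrite integral_sum//=; last by move=> i; exact: integrableZl.
  apply: big1 => i _; rewrite integralZl// -[RHS](mule0 (c n i)%:E); congr (_ * _)%E.
  rewrite -[RHS](U0 _ (GB n i)) [RHS]integral_mkcond.
  apply: eq_integral => w _; rewrite patchE indicE.
  by case: ifPn => _; rewrite ?mul1r ?mul0r.
have iW := iWU W M mWT WM.
apply/eqP; rewrite -abse_eq0 eq_le abse_ge0 andbT.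
apply/lee_addgt0Pr => e e0; rewrite add0e.
have iabs : (\int[P]_w `|(U w)%:E| < +oo)%E by case/integrableP : iU.
pose C := fine (\int[P]_w `|(U w)%:E|)%E.
have CE : (\int[P]_w `|(U w)%:E|)%E = C%:E.
  by rewrite fineK// ge0_fin_numE// integral_ge0.
have C0 : 0 <= C by rewrite /C fine_ge0// integral_ge0.
pose n := Num.bound (C / e).
have -> : (\int[P]_w (W w * U w)%:E =
    \int[P]_w ((W w * U w)%:E - (Wn n w * U w)%:E))%E.
  by rewrite integralB// Wn0 sube0.
apply: le_trans (le_abse_integral _ measurableT _) _.
  by apply: emeasurable_funB; [exact: (measurable_int P iW)|exact: (measurable_int P (iWn n))].
apply: (@le_trans _ _ (\int[P]_w ((n.+1%:R^-1)%:E * `|(U w)%:E|))%E).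
  apply: ge0_le_integral_nonmeasurable => w; first exact: abse_ge0.
  rewrite -EFinB -mulrBl /= lee_fin normrM ler_wpM2r//.
  have /andP[w1 w2] := idxP n w; rewrite ger0_norm ?subr_ge0// lerBlDr addrC.
  exact: ltW.
rewrite ge0_integralZl//; last by apply: measurableT_comp => //; exact/measurable_EFinP.
rewrite CE lee_fin mulrC ler_pdivrMr// mulrC -ler_pdivrMr//.
have h : C / e < n%:R by apply: archi_boundP; rewrite divr_ge0// ltW.
by apply/ltW/(lt_trans h); rewrite ltr_nat.
Qed.

End pull_out.

Section bounded_formula.
Context {R : realType} {d : measure_display} {T : measurableType d}.
Variables (P : probability T R) (F : R -> set_system T).
Variables (L : T -> \bar R) (Z : R -> T -> R) (A : T -> cumulative R R).
Hypotheses (uF : usual_filtration P F) (hL : honest_time P F L).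
Hypotheses (avL : avoids_stopping_times P F L).
Hypothesis ZL : azema_supermartingale P F L Z.
Hypothesis dL : dual_optional_projection P F L A.

(** As A_oo = A_t on the event L <= t,
      1_(t < L) g(A_oo) = g(A_oo) - g(A_t) + 1_(t < L) g(A_t).
    Inserted in [dual_chain_rule], this expresses the mean of (g - G)(A_oo) on
    [B] by A_t and by 1_(t < L), which may be replaced by Z_t. *)
Lemma bounded_azema_formula (G g : R -> R) (M : R) (B : set T) (t : R) :
  continuous g -> (forall x, `|g x| <= M) ->
  measurable_fun setT G -> (forall x, `|G x| <= M) ->
  (forall a b, a <= b ->
     (\int[lebesgue_measure]_(x in `[a, b]) (g x)%:E = (G b - G a)%:E)%E) ->
  0 <= t -> F t B ->
  (\int[P]_w (\1_B w * (g (terminal A w) - G (terminal A w)))%:E =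
   \int[P]_w (\1_B w * (Z t w * - G (A w t) +
      (1 - Z t w) * (g (A w t) - G (A w t))))%:E)%E.
Proof.
move=> cg gM mG GM gG t0 FB.
have sF := filtration_sigma uF t0.
have FT := filtration_event uF t0.
have mB : measurable B by exact: FT.
have mg : measurable_fun setT g by exact: continuous_measurable_fun.
have mT := terminal_measurable uF hL avL dL.
have mA := A_measurable uF dL t0.
have [_ /(_ t t0)[iX iZ mZ ZX]] := ZL.
set X := \1_[set w | (t%:E < L w)%E] in iX ZX.
have B1 w : 0 <= (\1_B w : R) <= 1.
  by rewrite indicE; case: (_ \in _); rewrite ?lexx ?ler01.
have X1 w : 0 <= X w <= 1.
  by rewrite /X indicE; case: (_ \in _); rewrite ?lexx ?ler01.
have bM (b f : T -> R) (M' : R) : (forall w, 0 <= b w <= 1) ->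
    (forall w, `|f w| <= M') -> forall w, `|b w * f w| <= M'.
  move=> b1 fM w; have /andP[b0 bw] := b1 w.
  by rewrite normrM ger0_norm// (le_trans _ (fM w))// ler_piMl.
have mX : measurable_fun setT X by exact/measurable_EFinP/(measurable_int P iX).
have m1B : measurable_fun setT (\1_B : T -> R) by exact: measurable_indic.
pose U1 w := \1_B w * (G (terminal A w) - G (A w t)).
pose V1 w := \1_B w * (X w * g (terminal A w)).
pose W w := \1_B w * g (A w t).
pose D w := Z t w - X w.
have iU1 : P.-integrable setT (EFin \o U1).
  apply: (@bounded_integrable _ _ _ _ _ (M + M)).
    apply: measurable_funM => //; apply: measurable_funB.
      exact: measurableT_comp mT.
    exact: measurableT_comp mA.
  apply: (bM _ _ _ B1) => w; apply: le_trans (ler_normB _ _) _; exact: lerD.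
have iV1 : P.-integrable setT (EFin \o V1).
  apply: (@bounded_integrable _ _ _ _ _ M).
    by do 2 apply: measurable_funM => //; exact: measurableT_comp mT.
  by apply: (bM _ _ _ B1); exact: (bM _ _ _ X1).
have iD : P.-integrable setT (EFin \o D).
  exact: (integrableB measurableT iZ iX).
have mW : measurable_wrt setT (F t) W.
  apply/(measurable_wrtP sF); apply: measurable_funM.
    by apply: measurable_indic; apply/measurable_sub_sigma_algebra.
  apply: measurableT_comp mg _; apply/(measurable_wrtP sF).
  exact: (A_adapted dL t0).
have WM : forall w, `|W w| <= M by apply: (bM _ _ _ B1) => w; exact: gM.
have mWT : measurable_fun setT W by exact: (measurable_wrt_measurable FT mW).
have WD0 : (\int[P]_w (W w * D w)%:E = 0)%E.
  apply: (integral_pull_out0 sF FT iD _ mW WM) => C FC.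
  have mC : measurable C by exact: FT.
  have iXC := integrableS measurableT mC (@subsetT _ _) iX.
  have iZC := integrableS measurableT mC (@subsetT _ _) iZ.
  rewrite [LHS](_ : _ = \int[P]_(w in C) ((Z t w)%:E - (X w)%:E))%E//.
  rewrite integralB// ZX// subee//.
  exact: integrable_fin_num.
have iWD : P.-integrable setT (fun w => (W w * D w)%:E).
  apply: (integrableMr measurableT mWT _ iD).
  exists M; split; first exact: num_real.
  by move=> N' NN' s _ /=; exact: le_trans (WM _) (ltW NN').
pose I1 w := \1_B w * (g (terminal A w) - G (terminal A w)).
pose I2 w := \1_B w * (Z t w * - G (A w t) + (1 - Z t w) * (g (A w t) - G (A w t))).
have iI1 : P.-integrable setT (EFin \o I1).
  apply: (@bounded_integrable _ _ _ _ _ (M + M)).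
    apply: measurable_funM => //; apply: measurable_funB; exact: measurableT_comp mT.
  by apply: (bM _ _ _ B1) => w; apply: le_trans (ler_normB _ _) _; exact: lerD.
pose J w := \1_B w * (g (A w t) - G (A w t)).
have iJ : P.-integrable setT (EFin \o J).
  apply: (@bounded_integrable _ _ _ _ _ (M + M)).
    apply: measurable_funM => //; apply: measurable_funB; exact: measurableT_comp mA.
  by apply: (bM _ _ _ B1) => w; apply: le_trans (ler_normB _ _) _; exact: lerD.
have iI2 : P.-integrable setT (EFin \o I2).
  rewrite (_ : EFin \o I2 = ((EFin \o J) \- (fun w => (W w * Z t w)%:E))%E).
    apply: integrableB => //; apply: (integrableMr measurableT mWT _ iZ).
    exists M; split; first exact: num_real.
    by move=> N' NN' s _ /=; exact: le_trans (WM _) (ltW NN').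
  apply/funext => w; rewrite /= -EFinB /I2 /J /W; congr EFin; ring.
have key : {ae P, forall w, I1 w - I2 w = (V1 w - U1 w) + W w * D w}.
  apply: filterS (ae_regular uF hL avL dL) => w rw.
  have : X w = 1 \/ (X w = 0 /\ terminal A w = A w t).
    rewrite /X indicE; case: (boolP (_ \in _)); first by left.
    rewrite notin_setE/= => /negP; rewrite -leNgt => Lt; right; split=> //.
    by rewrite (regular_flat rw Lt).
  by rewrite /I1 /I2 /V1 /U1 /W /D => -[->|[-> ->]]; ring.
have E0 : (\int[P]_w (I1 w - I2 w)%:E = 0)%E.
  rewrite (ae_eq_integral (fun w => (V1 w - U1 w + W w * D w)%:E)) //.
  - rewrite [LHS](_ : _ = \int[P]_w ((V1 w)%:E - (U1 w)%:E + (W w * D w)%:E))%E//.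
    rewrite integralD//; last exact: integrableB.
    rewrite integralB// WD0 adde0.
    rewrite [X in (X - _)%E](_ : _ = \int[P]_w (U1 w)%:E)%E; last first.
      by rewrite -(dual_chain_rule uF hL avL dL cg gM mG gG t0 FB).
    by rewrite subee//; exact: integrable_fin_num.
  - exact: (measurable_int P (integrableB measurableT iI1 iI2)).
  - exact: (measurable_int P (integrableD measurableT (integrableB measurableT iV1 iU1) iWD)).
  - by apply: filterS key => w /= ->.
have := E0.
rewrite [X in (X = _)%E -> _](_ : _ = \int[P]_w ((I1 w)%:E - (I2 w)%:E))%E//.
rewrite integralB//.
have f1 := integrable_fin_num measurableT iI1.
have f2 := integrable_fin_num measurableT iI2.
rewrite -(fineK f1) -(fineK f2) -EFinB => -[] /eqP.
by rewrite subr_eq0 => /eqP ->.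
Qed.

End bounded_formula.

(** * The transform of a weighted function *)

Section phi_hat_analysis.
Context {R : realType}.
Local Notation leb := (@lebesgue_measure R).

Lemma continuous_expN : continuous (fun y : R => expR (- y)).
Proof. by move=> y; apply: (cvg_comp _ _ (cvgN cvg_id)); exact: continuous_expR. Qed.

Lemma is_derive_expN (y : R) : is_derive y 1 (fun y => - expR (- y)) (expR (- y)).
Proof.
have -> : (fun y : R => - expR (- y)) = - (expR \o -%R) by [].
have h : is_derive y 1 (expR \o -%R) (expR (- y) * (-1)).
  by rewrite -[_ * _]/(_ *: _); apply: is_derive1_comp.
by apply: is_derive_eq; rewrite mulrN1 opprK.
Qed.

Lemma integral_expN (x : R) :
  (\int[leb]_(y in `[x, +oo[) (expR (- y))%:E = (expR (- x))%:E)%E.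
Proof.
rewrite (@ge0_continuous_FTC2y _ _ (fun y => - expR (- y)) _ 0).
- by rewrite sub0e -EFinN opprK.
- by move=> y _; exact: expR_ge0.
- by apply: continuous_subspaceT; exact: continuous_expN.
- by rewrite -oppr0; apply: cvgN; exact: cvgr_expR.
- by move=> y _; case: (is_derive_expN y).
- apply: cvg_at_right_filter; apply: cvgN; exact: continuous_expN.
- by move=> y _; have dy := is_derive_expN y; rewrite derive1E derive_val.
Qed.

Lemma measurable_expN (D : set R) : measurable_fun D (fun y : R => expR (- y)).
Proof.
by apply: measurable_funTS; apply: continuous_measurable_fun; exact: continuous_expN.
Qed.

Lemma measurable_weighted (psi : R -> R) (D : set R) : measurable_fun setT psi ->
  measurable_fun D (fun y => (expR (- y) * psi y)%:E).
Proof.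
move=> mpsi; apply: measurable_funTS; apply/measurable_EFinP/measurable_funM => //.
exact: measurable_expN.
Qed.

Section bounded.
Variables (psi : R -> R) (C : R).
Hypotheses (cpsi : continuous psi) (psiC : forall x, `|psi x| <= C).

Let h y := expR (- y) * psi y.

Let mpsi : measurable_fun setT psi. Proof. exact: continuous_measurable_fun. Qed.

Let ch : continuous h.
Proof. by move=> y; apply: cvgM; [exact: continuous_expN|exact: cpsi]. Qed.

Lemma integrable_weighted_bounded (x : R) :
  leb.-integrable `[x, +oo[ (fun y => (expR (- y) * psi y)%:E).
Proof.
apply: (@le_integrable _ _ _ leb _ _ _ (fun y => (C * expR (- y))%:E)) => //.
- exact: measurable_weighted.
- move=> y _; rewrite /= lee_fin [leRHS]ger0_norm; last first.
    by rewrite mulr_ge0 ?expR_ge0// (le_trans _ (psiC 0)).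
  by rewrite normrM (ger0_norm (expR_ge0 _)) mulrC ler_wpM2r// expR_ge0.
- apply: (@integrableZl _ _ _ leb _ (measurable_itv _) C (fun y => (expR (- y))%:E)).
  apply/integrableP; split.
    apply/measurable_EFinP; exact: measurable_expN.
  under eq_integral do rewrite gee0_abs ?lee_fin ?expR_ge0//.
  by rewrite integral_expN ltry.
Qed.

Lemma phi_hat_bounded x : `|phi_hat psi x| <= C.
Proof.
have C0 : 0 <= C by rewrite (le_trans _ (psiC 0)).
rewrite /phi_hat normrM ger0_norm ?expR_ge0//.
have -> : C = expR x * (C * expR (- x)).
  by rewrite mulrCA expRxMexpNx_1 mulr1.
rewrite ler_wpM2l ?expR_ge0//.
have ih := integrable_weighted_bounded x.
apply: (le_trans (le_normr_Rintegral _ ih)) => //.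
rewrite -lee_fin fineK; last first.
  rewrite ge0_fin_numE; last by apply: integral_ge0 => y _; rewrite lee_fin.
  by have /integrableP[_] := ih.
apply: (@le_trans _ _ (\int[leb]_(y in `[x, +oo[) (C%:E * (expR (- y))%:E))%E).
  apply: ge0_le_integral => //.
  - exact: (measurable_int leb (integrable_abse ih)).
  - apply/measurable_EFinP/measurable_funTS/measurable_funM => //.
    exact: measurable_expN.
  - move=> y _; rewrite lee_fin normrM (ger0_norm (expR_ge0 _)) mulrC.
    by rewrite ler_wpM2r// expR_ge0.
rewrite ge0_integralZl_EFin//.
- by rewrite integral_expN.
- by apply/measurable_EFinP; exact: measurable_expN.
Qed.

(** The transform solves the equation y' = y - psi, so that G = - phi_hat psi
    and g = G' satisfy g - G = psi. *)
Lemma is_derive_phi_hat (x : R) : is_derive x 1 (phi_hat psi) (phi_hat psi x - psi x).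
Proof.
pose tail y := \int[leb]_(z in `[y, +oo[) h z.
have dtail : is_derive x 1 tail (- h x).
  pose a := x - 1; pose Fa y := \int[leb]_(z in `[a, y]) h z.
  have [dF dFE] : derivable Fa x 1 /\ (Fa^`()%classic x = h x).
    apply: (@continuous_FTC1_closed _ h a x (x + 1)) => //.
    - by rewrite ltrDl.
    - apply: integrableS (integrable_weighted_bounded a) => //.
      exact: subset_itvl.
    - by rewrite /a ltrBlDr ltrDl.
    - exact: ch.
  have nearE : \forall y \near x, tail a - Fa y = tail y.
    near=> y; rewrite /tail /Fa Rintegral_itvB ?bnd_simp//.
    - rewrite Rintegral_itv_obnd_cbnd//.
      apply: integrableS (integrable_weighted_bounded y) => //.
      by apply: subset_itvr; rewrite bnd_simp.
    - exact: integrable_weighted_bounded.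
    - by rewrite ltW//; near: y; apply: lt_nbhsr; rewrite /a ltrBlDr ltrDl.
  have dFa : is_derive x 1 Fa (h x).
    by move: dFE; rewrite derive1E; exact: DeriveDef dF.
  have dT : is_derive x 1 (fun y => tail a - Fa y) (- h x).
    have -> : (fun y => tail a - Fa y) = cst (tail a) - Fa by [].
    by apply: is_derive_eq; rewrite sub0r.
  exact: near_eq_is_derive nearE dT.
have -> : phi_hat psi = (expR : R -> R) * tail by [].
apply: is_derive_eq; rewrite /= /GRing.scale/= /h.
rewrite mulrN mulrA expRxMexpNx_1 mul1r addrC; congr (_ - _).
by rewrite mulrC.
Unshelve. all: end_near. Qed.

Lemma continuous_phi_hat : continuous (phi_hat psi).
Proof.
move=> x; apply/differentiable_continuous/derivable1_diffP.
by case: (is_derive_phi_hat x).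
Qed.

Lemma integral_psi_sub_phi_hat (a b : R) : a <= b ->
  (\int[leb]_(x in `[a, b]) (psi x - phi_hat psi x)%:E =
   (- phi_hat psi b - - phi_hat psi a)%:E)%E.
Proof.
rewrite le_eqVlt => /predU1P[<-|ab].
  by rewrite set_itv1 integral_set1 subrr.
rewrite (@continuous_FTC2 _ _ (fun x => - phi_hat psi x))//.
- apply: continuous_subspaceT => x; apply: cvgB; first exact: cpsi.
  exact: continuous_phi_hat.
- split.
  + by move=> x _; apply: derivableN; case: (is_derive_phi_hat x).
  + by apply: cvg_at_right_filter; apply: cvgN; exact: continuous_phi_hat.
  + by apply: cvg_at_left_filter; apply: cvgN; exact: continuous_phi_hat.
- move=> x _; have dx := is_derive_phi_hat x.
  have : is_derive x 1 (- phi_hat psi) (- (phi_hat psi x - psi x)) by exact: is_deriveN.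
  by rewrite derive1E opprB; case.
Qed.

End bounded.

Section convergence.
Variables (psi : R -> R) (psin : (R -> R)^nat).
Hypotheses (mpsi : measurable_fun setT psi)
  (mpsin : forall n, measurable_fun setT (psin n)).
Hypothesis psi_int :
  leb.-integrable `[0, +oo[ (fun y => (expR (- y) * psi y)%:E).

Lemma integrable_weighted x : 0 <= x ->
  leb.-integrable `[x, +oo[ (fun y => (expR (- y) * psi y)%:E).
Proof. by move=> x0; apply: integrableS psi_int => //; exact: subset_itvr. Qed.

Lemma phi_hat_abs_ge x (f : R -> R) : 0 <= x -> measurable_fun setT f ->
  (forall y, `|f y| <= `|psi y|) ->
  `|phi_hat f x| <= phi_hat (fun y => `|psi y|) x.
Proof.
move=> x0 mf fpsi; rewrite /phi_hat normrM ger0_norm ?expR_ge0//.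
rewrite ler_wpM2l ?expR_ge0//.
have ipsi := integrable_weighted x0.
have ifx : leb.-integrable `[x, +oo[ (fun y => (expR (- y) * f y)%:E).
  apply: le_integrable ipsi => //; first exact: measurable_weighted.
  by move=> y _; rewrite /= lee_fin !normrM ler_wpM2l.
apply: (le_trans (le_normr_Rintegral _ ifx)) => //.
apply: le_Rintegral => //.
- exact: integrable_norm ifx.
- apply: eq_integrable (integrable_norm ipsi) => // y _.
  by rewrite /= normrM ger0_norm// expR_ge0.
- by move=> y _; rewrite normrM ger0_norm ?expR_ge0// ler_wpM2l// expR_ge0.
Qed.

Hypothesis psin_psi : forall x, psin n x @[n --> \oo] --> psi x.
Hypothesis psin_le : forall n x, `|psin n x| <= `|psi x|.

Lemma phi_hat_cvg x : 0 <= x ->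
  phi_hat (psin n) x @[n --> \oo] --> phi_hat psi x.
Proof.
move=> x0; apply: cvgMr.
have ipsi := integrable_weighted x0.
pose f n y := (expR (- y) * psin n y)%:E.
pose f' y := (expR (- y) * psi y)%:E.
have ff : {ae leb, forall y, `[x, +oo[%classic y -> f ^~ y @ \oo --> f' y}.
  apply: aeW => y _; apply: cvg_EFin; first by near=> n.
  by apply: cvgMr; exact: psin_psi.
have fle : {ae leb, forall y n, `[x, +oo[%classic y -> (`|f n y| <= `|f' y|)%E}.
  by apply: aeW => y n _; rewrite /f /f' lee_fin !normrM ler_wpM2l.
have [_ _ cvf] := @dominated_convergence _ (measurableTypeR R) R leb
  `[x, +oo[%classic (measurable_itv _) f f' (abse \o f')
  (fun n => measurable_weighted (mpsin n)) (measurable_weighted mpsi)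
  ff (integrable_abse ipsi) fle.
by apply: fine_cvg; rewrite fineK//; exact: integrable_fin_num.
Unshelve. all: end_near. Qed.

End convergence.

End phi_hat_analysis.

(** * Truncation, and the law of the terminal value *)

Section truncation.
Context {R : realType}.

Definition clamp (n : nat) (y : R) : R := Num.max (- n%:R) (Num.min n%:R y).

Lemma continuous_clamp n : continuous (clamp n).
Proof.
move=> y; have mc : {for y, continuous (cst (n%:R : R) \min (id : R -> R))}.
  by apply: continuous_min => //; exact: cvg_cst.
by apply: (continuous_max _ mc); exact: cvg_cst.
Qed.

Lemma clampP n y : [/\ `|clamp n y| <= n%:R, `|clamp n y| <= `|y| &
  `|y| <= n%:R -> clamp n y = y].
Proof.
have n0 : 0 <= n%:R :> R by [].
have Nn : - n%:R <= n%:R :> R by rewrite (le_trans _ n0)// oppr_le0.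
rewrite /clamp; have [ny|yn] := leP n%:R y.
  have y0 := le_trans n0 ny.
  rewrite (elimT max_idPr Nn) (ger0_norm n0) (ger0_norm y0); split=> // yn.
  by apply/eqP; rewrite eq_le ny yn.
have [ny|yn'] := leP (- n%:R) y.
  by split=> //; rewrite ler_norml ny ltW.
have y0 : y < 0 by rewrite (lt_le_trans yn')// oppr_le0.
rewrite normrN (ger0_norm n0) (ltr0_norm y0); split=> //.
  by rewrite lerNr ltW.
by rewrite lerNl => nyy; move: yn'; rewrite ltNge nyy.
Qed.

Lemma clamp_cvg y : clamp n y @[n --> \oo] --> y.
Proof.
apply: cvg_near_cst; near=> n; have [_ _] := clampP n y; apply.
near: n; exact: nbhs_infty_ger.
Unshelve. all: end_near. Qed.

Lemma clamp_ge0 n y : 0 <= y -> 0 <= clamp n y.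
Proof. by move=> y0; rewrite /clamp le_max le_min y0 ler0n orbT. Qed.

Lemma le_clamp m n y : (m <= n)%N -> 0 <= y -> clamp m y <= clamp n y.
Proof.
move=> mn y0; rewrite {1}/clamp ge_max; apply/andP; split.
  by rewrite (@le_trans _ _ 0) ?clamp_ge0// oppr_le0.
rewrite /clamp le_max; apply/orP; right.
by rewrite le_min !ge_min ler_nat mn lexx orbT.
Qed.

Lemma within_ge0_continuous_comp (phi : R -> R) :
  {within `[0, +oo[, continuous phi} -> continuous (fun x : R => phi (Num.max 0 x)).
Proof.
move=> /subspace_continuousP cphi x.
have x0 : `[0, +oo[%classic (Num.max 0 x) by rewrite /= in_itv/= andbT le_max lexx.
have mc : Num.max 0 y @[y --> x] --> Num.max 0 x.
  by apply: (continuous_max (f := cst 0) (g := id)) => //; exact: cvg_cst.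
apply: (@cvg_comp _ _ _ (fun y => Num.max 0 y) phi _ _ _ _ (cphi _ x0)).
move=> U HU; have nU := mc _ HU.
change (\forall y \near x, U (Num.max 0 y)).
change (\forall y \near x, `[0, +oo[%classic (Num.max 0 y) -> U (Num.max 0 y)) in nU.
apply: filterS nU => y; apply; by rewrite /= in_itv/= andbT le_max lexx.
Qed.

End truncation.

Section azema_formula.
Context {R : realType} {d : measure_display} {T : measurableType d}.
Variables (P : probability T R) (F : R -> set_system T).
Variables (L : T -> \bar R) (Z : R -> T -> R) (A : T -> cumulative R R).
Hypotheses (uF : usual_filtration P F) (hL : honest_time P F L).
Hypotheses (avL : avoids_stopping_times P F L).
Hypothesis ZL : azema_supermartingale P F L Z.
Hypothesis dL : dual_optional_projection P F L A.
Local Notation leb := (@lebesgue_measure R).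
Local Notation Aoo := (terminal A).

Definition azema_mix (psi : R -> R) t w : R :=
  Z t w * phi_hat psi (A w t) + (1 - Z t w) * psi (A w t).

Lemma azema_mix_bounded (psi : R -> R) (C : R) (B : set T) t :
  continuous psi -> (forall x, `|psi x| <= C) -> 0 <= t -> F t B ->
  (\int[P]_(w in B) (psi (Aoo w))%:E = \int[P]_(w in B) (azema_mix psi t w)%:E)%E.
Proof.
move=> cpsi psiC t0 FB.
have chat := continuous_phi_hat cpsi psiC.
have hatC := phi_hat_bounded cpsi psiC.
have C0 : 0 <= C by rewrite (le_trans _ (psiC 0)).
have := @bounded_azema_formula _ _ _ P F L Z A uF hL avL ZL dL
  (fun x => - phi_hat psi x) (fun x => psi x - phi_hat psi x) (C + C) B t _ _ _ _
  (integral_psi_sub_phi_hat cpsi psiC) t0 FB.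
have patchB (f : T -> R) :
    (\int[P]_(w in B) (f w)%:E = \int[P]_w (\1_B w * f w)%:E)%E.
  rewrite integral_mkcond; apply: eq_integral => w _; rewrite patchE indicE.
  by case: ifPn => _; rewrite ?mul1r ?mul0r.
rewrite !patchB => H; rewrite (eq_integral (fun w =>
    (\1_B w * (psi (Aoo w) - phi_hat psi (Aoo w) - - phi_hat psi (Aoo w)))%:E)).
  rewrite H.
  - by apply: eq_integral => w _; rewrite /azema_mix !opprK subrK.
  - by move=> x; apply: cvgB; [exact: cpsi|exact: chat].
  - by move=> x; apply: (le_trans (ler_normB _ _)); exact: lerD.
  - apply: continuous_measurable_fun => x; apply: cvgN; exact: chat.
  - by move=> x; rewrite normrN (le_trans (hatC x))// lerDl.
by move=> w _; rewrite opprK subrK.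
Qed.

(** On the event that [Z t] is at most - 1/n, an event of the past, the mean of
    [Z t] is also that of a nonnegative variable; so the event is null. The
    same applies to 1 - [Z t]. *)
Lemma azema_01 t : 0 <= t -> {ae P, forall w, 0 <= Z t w <= 1}.
Proof.
move=> t0; have sF := filtration_sigma uF t0; have FT := filtration_event uF t0.
have [_ /(_ t t0)[iX iZ mZ ZX]] := ZL.
have h (Y X : T -> R) : P.-integrable setT (EFin \o X) ->
    P.-integrable setT (EFin \o Y) -> measurable_wrt setT (F t) Y ->
    (forall B, F t B -> \int[P]_(w in B) (Y w)%:E = \int[P]_(w in B) (X w)%:E)%E ->
    (forall w, 0 <= X w) -> {ae P, forall w, 0 <= Y w}.
  move=> iX' iY mY YX X0.
  pose B (n : nat) := Y @^-1` `]-oo, - n.+1%:R^-1]%classic.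
  have FB n : F t (B n).
    by apply: mY; exists `]-oo, - n.+1%:R^-1]%classic => //; rewrite setTI.
  have mB n : measurable (B n) by exact: FT.
  have PB n : P (B n) = 0%E.
    have n0 : 0 < n.+1%:R^-1 :> R by rewrite invr_gt0.
    apply/eqP; rewrite eq_le measure_ge0 andbT.
    suff : ((n.+1%:R^-1)%:E * P (B n) <= 0)%E by rewrite pmule_rle0// lte_fin.
    rewrite -oppe_ge0 -mulNe -EFinN -integral_cst//.
    apply: (@le_trans _ _ (\int[P]_(w in B n) (X w)%:E)%E).
      by apply: integral_ge0 => w _; rewrite lee_fin.
    rewrite -YX//; apply: le_integral => //.
    - exact: (integrableS measurableT).
    - exact: finite_measure_integrable_cst.
    - by move=> w; rewrite inE /B /= in_itv/= lee_fin.
  apply: negligibleS (negligible_bigcup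
    (fun n => (negligibleP P (mB n)).2 (PB n))).
  move=> w /= /negP; rewrite -ltNge => Y0.
  exists (Num.bound (- Y w)^-1) => //; rewrite /B /= in_itv/= lerNr.
  rewrite invf_ple ?posrE ?oppr_gt0//.
  set x := _^-1; have hx : x < (Num.bound x)%:R.
    by apply: archi_boundP; rewrite invr_ge0 oppr_ge0 ltW.
  by apply/ltW/(lt_trans hx); rewrite ltr_nat.
pose X := \1_[set w | (t%:E < L w)%E] : T -> R.
have Z0 : {ae P, forall w, 0 <= Z t w} by apply: (h _ _ iX iZ mZ ZX).
have i1 : P.-integrable setT (EFin \o cst (1 : R)) by exact: finite_measure_integrable_cst.
have Z1 : {ae P, forall w, 0 <= 1 - Z t w}.
  apply: (h _ (fun w => 1 - X w)).
  - exact: (integrableB measurableT i1 iX).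
  - exact: (integrableB measurableT i1 iZ).
  - apply/(measurable_wrtP sF); apply: measurable_funB; first exact: measurable_cst.
    exact/(measurable_wrtP sF).
  - move=> B FB; have mB := FT _ FB.
    have iB f : P.-integrable setT f -> P.-integrable B f by exact: integrableS.
    transitivity (\int[P]_(w in B) ((1 : R)%:E - (Z t w)%:E))%E => //.
    rewrite (integralB mB (iB _ i1) (iB _ iZ)) ZX//.
    by rewrite -(integralB mB (iB _ i1) (iB _ iX)).
  - by move=> w; rewrite /X indicE; case: (_ \in _); rewrite ?subrr ?subr0.
by apply: filterS2 Z0 Z1 => w -> /=; rewrite subr_ge0.
Qed.

Lemma azema0_integral : (\int[P]_w (Z 0 w)%:E = 1)%E.
Proof.
have [_ /(_ 0 (lexx 0))[_ _ _ ZX]] := ZL.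
rewrite ZX; last exact: (salgT (filtration_sigma uF (lexx 0))).
have mL := measurable_lte measurableT (measurable_cst 0%:E) (measurable_L hL).
rewrite setTI in mL.
rewrite integral_indic// setIT -(probability_setT P).
have PL0 : P [set w | L w = 0%E] = 0%E by case: hL.
have mL0 : measurable [set w | L w = 0%E].
  by have := measurable_eqe measurableT (measurable_L hL) (measurable_cst 0%E); rewrite setTI.
rewrite (_ : setT = [set w | (0%:E < L w)%E] `|` [set w | L w = 0%E]).
  by rewrite measureU0.
apply/seteqP; split=> w //= _; have := L_ge0 hL w.
by rewrite le_eqVlt => /predU1P[<-|]; [right|left].
Qed.

(** The terminal value is exponentially distributed: at time 0 the formula
    reads E[psi(A_oo)] = phi_hat psi 0, because A_0 = 0 and E[Z_0] = 1. *)
Lemma terminal_law_bounded (psi : R -> R) (C : R) :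
  continuous psi -> (forall x, `|psi x| <= C) ->
  (\int[P]_w (psi (Aoo w))%:E = (phi_hat psi 0)%:E)%E.
Proof.
move=> cpsi psiC.
rewrite (azema_mix_bounded cpsi psiC (lexx 0)); last first.
  exact: (salgT (filtration_sigma uF (lexx 0))).
have [_ /(_ 0 (lexx 0))[_ iZ _ _]] := ZL.
pose k := phi_hat psi 0 - psi 0.
have mA := A_measurable uF dL (lexx 0).
have mZ : measurable_fun setT (Z 0) by exact/measurable_EFinP/(measurable_int P iZ).
have E : {ae P, forall w, azema_mix psi 0 w = k * Z 0 w + psi 0}.
  apply: filterS (ae_regular uF hL avL dL) => w rw.
  by rewrite /azema_mix (regular_A0 dL rw) /k; ring.
rewrite (ae_eq_integral (fun w => (k * Z 0 w + psi 0)%:E))//.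
- transitivity (\int[P]_w (k%:E * (Z 0 w)%:E + (psi 0)%:E))%E => //.
  rewrite integralD//; last 2 first.
    exact: integrableZl.
    exact: finite_measure_integrable_cst.
  rewrite integralZl// azema0_integral integral_cst//= probability_setT !mule1.
  by rewrite -EFinD /k subrK.
- apply/measurable_EFinP/measurable_funD; apply: measurable_funM => //.
  + apply: measurableT_comp mA; apply: continuous_measurable_fun.
    exact: continuous_phi_hat psiC.
  + by apply: measurable_funB.
  + apply: measurableT_comp mA; exact: continuous_measurable_fun.
- apply/measurable_EFinP/measurable_funD => //; exact: measurable_funM.
- by apply: filterS E => w /= ->.
Qed.

Lemma terminal_law_ge0 (psi : R -> R) : continuous psi -> (forall x, 0 <= psi x) ->
  (\int[P]_w (psi (Aoo w))%:E =
   \int[leb]_(y in `[0%R, +oo[) (expR (- y) * psi y)%:E)%E.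
Proof.
move=> cpsi psi0.
have mpsi : measurable_fun setT psi by exact: continuous_measurable_fun.
have mT := terminal_measurable uF hL avL dL.
pose psin n x := clamp n (psi x).
have cpsin n : continuous (psin n).
  move=> x; apply: (@cvg_comp _ _ _ psi (clamp n) _ _ _ (cpsi x)).
  exact: (@continuous_clamp R n (psi x)).
have mpsin n : measurable_fun setT (psin n) by exact: continuous_measurable_fun.
have psinC n x : `|psin n x| <= n%:R by have [] := clampP n (psi x).
have cv1 : (\int[P]_w (psin n (Aoo w))%:E @[n --> \oo] -->
    \int[P]_w (psi (Aoo w))%:E)%E.
  have := @cvg_monotone_convergence _ _ _ P setT measurableT
    (fun n w => (psin n (Aoo w))%:E).
  under [X in (_ -> _ -> _ -> _ --> X) -> _]eq_integral => w _.
    have /cvg_lim -> // : (psin n (Aoo w))%:E @[n --> \oo] --> (psi (Aoo w))%:E.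
      by apply: cvg_EFin; [near=> n|exact: clamp_cvg].
    over.
  apply.
  - by move=> n; apply/measurable_EFinP; exact: measurableT_comp mT.
  - by move=> n w _; rewrite lee_fin clamp_ge0.
  - by move=> w _ m n mn; rewrite lee_fin le_clamp.
have cv2 : (\int[leb]_(y in `[0%R, +oo[) (expR (- y) * psin n y)%:E @[n --> \oo] -->
    \int[leb]_(y in `[0%R, +oo[) (expR (- y) * psi y)%:E)%E.
  have := @cvg_monotone_convergence _ (measurableTypeR R) R leb `[0, +oo[%classic
    (measurable_itv _) (fun n y => (expR (- y) * psin n y)%:E).
  under [X in (_ -> _ -> _ -> _ --> X) -> _]eq_integral => y _.
    have /cvg_lim -> // : (expR (- y) * psin n y)%:E @[n --> \oo] -->
        (expR (- y) * psi y)%:E.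
      by apply: cvg_EFin; [near=> n|apply: cvgMr; exact: clamp_cvg].
    over.
  apply.
  - by move=> n; exact: measurable_weighted.
  - by move=> n y _; rewrite lee_fin mulr_ge0 ?expR_ge0// clamp_ge0.
  - by move=> y _ m n mn; rewrite lee_fin ler_wpM2l ?expR_ge0// le_clamp.
apply: (cvg_unique _ cv1) => //=.
apply: cvg_trans cv2; apply: near_eq_cvg; near=> n.
rewrite (terminal_law_bounded (cpsin n) (psinC n)) /phi_hat expR0 mul1r fineK//.
apply: integrable_fin_num => //.
exact: integrable_weighted_bounded (cpsin n) (psinC n) 0.
Unshelve. all: end_near. Qed.

End azema_formula.

(** * The conditional expectation of a function of the terminal value *)

Section conditional_expectation.
Context {R : realType} {d : measure_display} {T : measurableType d}.
Variables (P : probability T R) (F : R -> set_system T).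
Variables (L : T -> \bar R) (Z : R -> T -> R) (A : T -> cumulative R R).
Hypotheses (uF : usual_filtration P F) (hL : honest_time P F L).
Hypotheses (avL : avoids_stopping_times P F L).
Hypothesis ZL : azema_supermartingale P F L Z.
Hypothesis dL : dual_optional_projection P F L A.
Local Notation leb := (@lebesgue_measure R).
Local Notation Aoo := (terminal A).

Lemma azema_mix_measurable (psi : R -> R) (C : R) t : continuous psi ->
  (forall x, `|psi x| <= C) -> 0 <= t ->
  measurable_wrt setT (F t) (azema_mix Z A psi t).
Proof.
move=> cpsi psiC t0; have sF := filtration_sigma uF t0.
have [_ /(_ t t0)[_ _ mZ _]] := ZL.
have mZ' := (measurable_wrtP sF (Z t)).1 mZ.
have mA := (measurable_wrtP sF (fun w => A w t)).1 (A_adapted dL t0).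
apply/(measurable_wrtP sF)/measurable_funD; apply: measurable_funM => //.
- apply: measurableT_comp mA; apply: continuous_measurable_fun.
  exact: continuous_phi_hat psiC.
- by apply: measurable_funB => //; exact: measurable_cst.
- apply: measurableT_comp mA; exact: continuous_measurable_fun.
Qed.

Lemma azema_mix_cvg (psi : R -> R) (psin : (R -> R)^nat) t w :
  measurable_fun setT psi -> (forall n, measurable_fun setT (psin n)) ->
  leb.-integrable `[0, +oo[ (fun y => (expR (- y) * psi y)%:E) ->
  (forall x, psin n x @[n --> \oo] --> psi x) ->
  (forall n x, `|psin n x| <= `|psi x|) ->
  azema_mix Z A (psin n) t w @[n --> \oo] --> azema_mix Z A psi t w.
Proof.
move=> mpsi mpsin ipsi cpsin lepsin; apply: cvgD; apply: cvgMr => //.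
by apply: phi_hat_cvg => //; exact: (A_ge0 dL).
Qed.

(** Clamp [psi] to [-n, n] and let n go to infinity. The law of the terminal
    value makes [psi] integrable for the exponential weight, hence the
    transforms converge. The right-hand sides are dominated by the one for
    |psi|, because 0 <= Z_t <= 1; that one is integrable by Fatou's lemma,
    since its clamped versions have mean at most E|psi(A_oo)|. *)
Lemma azema_cond_expectation (psi : R -> R) t : continuous psi ->
  (\int[P]_w `|psi (Aoo w)|%:E < +oo)%E -> 0 <= t ->
  cond_expectation P (F t) (fun w => psi (Aoo w)) (azema_mix Z A psi t).
Proof.
move=> cpsi Epsi t0.
have sF := filtration_sigma uF t0; have FT := filtration_event uF t0.
have mpsi : measurable_fun setT psi by exact: continuous_measurable_fun.
have mT := terminal_measurable uF hL avL dL.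
pose psin n x := clamp n (psi x).
have cpsin n : continuous (psin n).
  move=> x; apply: (@cvg_comp _ _ _ psi (clamp n) _ _ _ (cpsi x)).
  exact: (@continuous_clamp R n (psi x)).
have mpsin n : measurable_fun setT (psin n) by exact: continuous_measurable_fun.
have psinC n x : `|psin n x| <= n%:R by have [] := clampP n (psi x).
have psin_le n x : `|psin n x| <= `|psi x| by have [] := clampP n (psi x).
have psin_cvg x : psin n x @[n --> \oo] --> psi x by exact: clamp_cvg.
pose apsi x := `|psi x|; pose apsin n x := `|psin n x|.
have capsi : continuous apsi by move=> x; apply: cvg_norm; exact: cpsi.
have capsin n : continuous (apsin n) by move=> x; apply: cvg_norm; exact: cpsin.
have mapsi : measurable_fun setT apsi by exact: continuous_measurable_fun.
have mapsin n : measurable_fun setT (apsin n) by exact: continuous_measurable_fun.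
have apsinC n x : `|apsin n x| <= n%:R by rewrite normr_id.
have apsin_le n x : `|apsin n x| <= `|apsi x| by rewrite !normr_id.
have apsin_cvg x : apsin n x @[n --> \oo] --> apsi x by apply: cvg_norm; exact: psin_cvg.
have law : (\int[leb]_(y in `[0%R, +oo[) (expR (- y) * apsi y)%:E < +oo)%E.
  by rewrite -(terminal_law_ge0 uF hL avL ZL dL capsi (fun x => normr_ge0 (psi x))).
have ipsi : leb.-integrable `[0, +oo[ (fun y => (expR (- y) * psi y)%:E).
  apply/integrableP; split; first exact: measurable_weighted.
  under eq_integral do rewrite /= normrM (ger0_norm (expR_ge0 _)).
  exact: law.
have iapsi : leb.-integrable `[0, +oo[ (fun y => (expR (- y) * apsi y)%:E).
  apply/integrableP; split; first exact: measurable_weighted.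
  under eq_integral do rewrite /= normrM (ger0_norm (expR_ge0 _)) normr_id.
  exact: law.
have iX : P.-integrable setT (EFin \o (fun w => psi (Aoo w))).
  by apply/integrableP; split => //; apply/measurable_EFinP; exact: measurableT_comp mT.
pose Y n := azema_mix Z A (psin n) t; pose Yoo := azema_mix Z A psi t.
pose Y' n := azema_mix Z A (apsin n) t; pose Y'oo := azema_mix Z A apsi t.
have mY n : measurable_wrt setT (F t) (Y n) by exact: azema_mix_measurable (psinC n) t0.
have mY' n : measurable_fun setT (Y' n).
  by apply: (measurable_wrt_measurable FT); exact: azema_mix_measurable (apsinC n) t0.
have Y_cvg w : Y n w @[n --> \oo] --> Yoo w by exact: azema_mix_cvg.
have Y'_cvg w : Y' n w @[n --> \oo] --> Y'oo w by exact: azema_mix_cvg.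
have mYoo : measurable_wrt setT (F t) Yoo.
  apply/(measurable_wrtP sF).
  apply: (@measurable_fun_cvg _ (g_sigma_algebraType (F t)) R setT Y Yoo) => [n|w _].
    exact/(measurable_wrtP sF).
  exact: Y_cvg.
have mY'oo : measurable_fun setT Y'oo by apply: (measurable_fun_cvg (h := Y')).
have Z01 := azema_01 uF ZL t0.
have Y'_le n : (\int[P]_w `|Y' n w|%:E <= \int[P]_w `|psi (Aoo w)|%:E)%E.
  rewrite (ae_eq_integral (fun w => (Y' n w)%:E))//.
  - rewrite -(azema_mix_bounded uF hL avL ZL dL (capsin n) (apsinC n) t0 (salgT sF)).
    apply: ge0_le_integral_nonmeasurable => w; first by rewrite lee_fin /apsin.
    by rewrite lee_fin; exact: psin_le.
  - by apply/measurable_EFinP; exact: measurableT_comp.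
  - exact/measurable_EFinP.
  - apply: filterS Z01 => w /andP[Z0 Z1] _; rewrite ger0_norm//.
    have a0 x : 0 <= apsin n x by exact: normr_ge0.
    rewrite /Y' /azema_mix addr_ge0//; last by rewrite mulr_ge0// subr_ge0.
    rewrite mulr_ge0// /phi_hat mulr_ge0 ?expR_ge0//; apply: Rintegral_ge0 => y _.
    by rewrite mulr_ge0 ?expR_ge0.
have iY'oo : P.-integrable setT (EFin \o Y'oo).
  apply/integrableP; split; first exact/measurable_EFinP.
  apply: le_lt_trans Epsi.
  have absE w : (`|(Y'oo w)%:E| = limn_einf (fun n => `|Y' n w|%:E))%E.
    have cvw : `|Y' n w|%:E @[n --> \oo] --> `|(Y'oo w)%:E|%E.
      apply: cvg_EFin; first by near=> n.
      by apply: cvg_norm; exact: Y'_cvg.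
    rewrite is_cvg_limn_einfE; first by rewrite (cvg_lim _ cvw).
    by apply/cvg_ex; eexists; exact: cvw.
  rewrite (eq_integral (fun w => limn_einf (fun n => `|Y' n w|%:E)%E)); last first.
    by move=> w _; exact: absE.
  apply: (@le_trans _ _ (limn_einf (fun n => \int[P]_w `|Y' n w|%:E)%E)).
    apply: fatou => // n.
    by apply/measurable_EFinP; exact: measurableT_comp.
  rewrite limn_einf_lim; apply: lime_le; first exact: is_cvg_einfs.
  near=> n; apply: le_trans (Y'_le n); apply: ereal_inf_lbound.
  by exists n => /=.
have Yle : {ae P, forall w n, setT w -> (`|(Y n w)%:E| <= (Y'oo w)%:E)%E}.
  apply: filterS Z01 => w /andP[Z0 Z1] n _; rewrite lee_fin /Y /Y'oo /azema_mix.
  apply: le_trans (ler_normD _ _) _.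
  rewrite (normrM (Z t w)) (normrM (1 - Z t w)) (ger0_norm Z0).
  rewrite (@ger0_norm _ (1 - Z t w)) ?subr_ge0//; apply: lerD.
    apply: ler_wpM2l => //.
    exact: (phi_hat_abs_ge ipsi (A_ge0 dL w t) (mpsin n) (psin_le n)).
  by apply: ler_wpM2l; [rewrite subr_ge0|exact: psin_le].
have mYT n : measurable_fun setT (Y n) by exact: (measurable_wrt_measurable FT).
have mYooT : measurable_fun setT Yoo by exact: (measurable_wrt_measurable FT).
have YB (B : set T) : measurable B -> P.-integrable B (EFin \o Yoo) /\
    (\int[P]_(w in B) (Y n w)%:E @[n --> \oo] --> \int[P]_(w in B) (Yoo w)%:E)%E.
  move=> mB; have [] := @dominated_convergence _ _ _ P B mB
    (fun n w => (Y n w)%:E) (EFin \o Yoo) (EFin \o Y'oo); last by [].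
  - by move=> n; apply/measurable_EFinP; exact: measurable_funTS.
  - by apply/measurable_EFinP; exact: measurable_funTS.
  - by apply: aeW => w _; apply: cvg_EFin; [near=> n|exact: Y_cvg].
  - exact: integrableS iY'oo.
  - by apply: filterS Yle => w h n _; exact: h.
have XB (B : set T) : measurable B ->
    (\int[P]_(w in B) (psin n (Aoo w))%:E @[n --> \oo] -->
     \int[P]_(w in B) (psi (Aoo w))%:E)%E.
  move=> mB; have [] := @dominated_convergence _ _ _ P B mB
    (fun n w => (psin n (Aoo w))%:E) (fun w => (psi (Aoo w))%:E)
    (abse \o (EFin \o (fun w => psi (Aoo w)))); last by [].
  - by move=> n; apply/measurable_EFinP/measurable_funTS; exact: measurableT_comp mT.
  - by apply/measurable_EFinP/measurable_funTS; exact: measurableT_comp mT.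
  - by apply: aeW => w _; apply: cvg_EFin; [near=> n|exact: psin_cvg].
  - by apply: integrable_abse; exact: integrableS iX.
  - by apply: aeW => w n _; rewrite lee_fin; exact: psin_le.
split=> //; first by have [] := YB setT measurableT.
move=> B FB; have mB := FT _ FB; have [_ cvY] := YB B mB.
apply: (cvg_unique _ cvY) => //=; apply: cvg_trans (XB B mB).
apply: near_eq_cvg; near=> n.
exact: (azema_mix_bounded uF hL avL ZL dL (cpsin n) (psinC n) t0 FB).
Unshelve. all: end_near. Qed.

End conditional_expectation.

Theorem proposition5p3 (R : realType) (d : measure_display)
    (T : measurableType d) (P : probability T R) (F : R -> set_system T)
    (L : T -> \bar R) (Z : R -> T -> R) (A : T -> cumulative R R)
    (phi : R -> R) :
  usual_filtration P F ->
  honest_time P F L ->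
  avoids_stopping_times P F L ->
  azema_supermartingale P F L Z ->
  dual_optional_projection P F L A ->
  {within `[0, +oo[, continuous phi} ->
  (('E_P[fun w => `|phi (terminal A w)|%R] < +oo)%E <->
   (\int[lebesgue_measure]_(x in `[0%R, +oo[)
      (`|phi x| * expR (- x))%:E < +oo)%E) /\
  (('E_P[fun w => `|phi (terminal A w)|%R] < +oo)%E ->
   (\int[lebesgue_measure]_(x in `[0%R, +oo[)
      (expR (- x) * `|phi x| * x)%:E < +oo)%E ->
   forall t, 0 <= t ->
     cond_expectation P (F t) (fun w => phi (terminal A w))
       (fun w => Z t w * phi_hat phi (A w t) + (1 - Z t w) * phi (A w t))).
Proof.
move=> uF hL avL ZL dL cphi.
(* [phi] is only continuous on the half-line; [psi] extends it by [phi 0]. *)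
pose psi x := phi (Num.max 0 x).
have cpsi : continuous psi by exact: within_ge0_continuous_comp.
have psiE x : 0 <= x -> psi x = phi x by move=> x0; rewrite /psi (elimT max_idPr x0).
have capsi : continuous (fun x => `|psi x|).
  by move=> x; apply: cvg_norm; exact: cpsi.
have mT := terminal_measurable uF hL avL dL.
have mpsiT : measurable_fun setT (fun w => psi (terminal A w)).
  by apply: measurableT_comp mT; exact: continuous_measurable_fun.
have psiT : {ae P, forall w, psi (terminal A w) = phi (terminal A w)}.
  apply: filterS (ae_regular uF hL avL dL) => w rw; apply: psiE.
  exact: (le_trans (A_ge0 dL w 0) (regular_A_le _ rw)).
have mphiT : measurable_fun setT (fun w => phi (terminal A w)).
  exact: (ae_complete_measurable uF mpsiT psiT).
have Eabs : (\int[P]_w `|phi (terminal A w)|%:E =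
    \int[P]_w `|psi (terminal A w)|%:E)%E.
  apply: ae_eq_integral => //.
  - by apply/measurable_EFinP; exact: measurableT_comp.
  - by apply/measurable_EFinP; exact: measurableT_comp.
  - by apply: filterS psiT => w /= ->.
have law : ('E_P[fun w => `|phi (terminal A w)|%R] =
    \int[lebesgue_measure]_(x in `[0%R, +oo[) (`|phi x| * expR (- x))%:E)%E.
  rewrite unlock Eabs (terminal_law_ge0 uF hL avL ZL dL capsi)//.
  apply: eq_integral => x; rewrite inE/= in_itv/= andbT => x0.
  by rewrite psiE// mulrC.
split; first by rewrite law.
rewrite unlock Eabs => Ephi _ t t0.
have FT := filtration_event uF t0.
have mixE : (fun w => Z t w * phi_hat phi (A w t) + (1 - Z t w) * phi (A w t)) =
    azema_mix Z A psi t.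
  apply/funext => w; have A0 := A_ge0 dL w t.
  rewrite /azema_mix psiE//; congr (_ * (_ * _) + _).
  apply: eq_Rintegral => y; rewrite inE/= in_itv/= andbT => Ay.
  by rewrite psiE// (le_trans A0).
rewrite mixE.
have [iX iY mY XY] := azema_cond_expectation uF hL avL ZL dL cpsi Ephi t0.
split=> //.
  apply/integrableP; split; first exact/measurable_EFinP.
  by rewrite /= Eabs.
move=> B FB; rewrite XY//; apply: ae_eq_integral.
- exact: FT.
- by apply/measurable_EFinP; exact: measurable_funTS.
- by apply/measurable_EFinP; exact: measurable_funTS.
- by apply: filterS psiT => w -> _.
Qed.
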